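(* For any truncatable pair $(\mu,\mathbf r)\in\mathbb P^\vee\times\mathcal R$, the set $\mathcal R^{\mathbf r}_\mu$ of $\mathbf e\in\mathcal R_\mu$ such that the $Y_\mu(\mathfrak g)$-module $L(\mathbf e)$ factorizes through the truncated shifted Yangian $Y^{\mathbf r}_\mu(\mathfrak g)$ is finite.
   Context: $\mathfrak g$ finite-dimensional complex simple Lie algebra, Dynkin nodes $I$, simple roots $\alpha_i$, $d_i=(\alpha_i,\alpha_i)/2$ coprime positive integers, Cartan matrix $c_{ij}$, $d_{ij}=(\alpha_i,\alpha_j)/2$, fundamental coweights $\varpi_i^\vee$, simple coroots $\alpha_i^\vee$ ($\langle\alpha_i^\vee,\alpha_j\rangle=c_{ij}$), $\mathbb P^\vee=\bigoplus\mathbb Z\varpi_i^\vee$, $\mathbb Q^\vee_+=\bigoplus\mathbb N\alpha_i^\vee$. $Y_\mu(\mathfrak g)$: shifted Yangian, generators $x^\pm_{i,n},\xi_{i,p}$ ($n\in\mathbb N,p\in\mathbb Z$), relations $[\xi_{i,p},\xi_{j,q}]=0$, $[x^+_{i,m},x^-_{j,n}]=\delta_{ij}\xi_{i,m+n}$, $[\xi_{i,p+1},x^\pm_{j,n}]-[\xi_{i,p},x^\pm_{j,n+1}]=\pm d_{ij}(\xi_{i,p}x^\pm_{j,n}+x^\pm_{j,n}\xi_{i,p})$, $[x^\pm_{i,m+1},x^\pm_{j,n}]-[x^\pm_{i,m},x^\pm_{j,n+1}]=\pm d_{ij}(x^\pm_{i,m}x^\pm_{j,n}+x^\pm_{j,n}x^\pm_{i,m})$,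 $\mathrm{ad}_{x^\pm_{i,0}}^{1-c_{ij}}(x^\pm_{j,0})=0$ ($i\ne j$), $\xi_{i,-\langle\mu,\alpha_i\rangle-1}=1$, $\xi_{i,p}=0$ for $p<-\langle\mu,\alpha_i\rangle-1$; $x_i^\pm(u)=\sum_nx^\pm_{i,n}u^{-n-1}$, $\xi_i(u)=\sum_p\xi_{i,p}u^{-p-1}$. $\mathcal L$: $I$-tuples of Laurent series in $u^{-1}$ with leading terms $u^{k_i}$, coweight $\varpi^\vee(\mathbf e)=\sum k_i\varpi_i^\vee$; $\Psi_{i,a}$: $u-a$ in position $i$, $1$ elsewhere; $\mathcal R$ the group generated by the $\Psi_{i,a}$; $\mathcal R_\mu=\{\mathbf e\in\mathcal R:\varpi^\vee(\mathbf e)=\mu\}$. $L(\mathbf e)$: irreducible $Y_{\varpi^\vee(\mathbf e)}$-module generated by $v$ with $x_i^+(u)v=0$, $\xi_i(u)v=\mathbf e_i(u)v$. A pair $(\mu,\mathbf r)$ is truncatable if $\varpi^\vee(\mathbf r)-\mu=\sum_im_i\alpha_i^\vee\in\mathbb Q^\vee_+$; its GKLO series are the unique Laurent series $A_i(u)$ in $u^{-1}$ with coefficients in the subalgebra generated by the $\xi_{j,p}$ and leading term $u^{m_i}$ satisfying $\xi_i(u)=\frac{\mathbf r_i(u)}{A_i(u)A_i(u-d_i)}\prod_{j:c_{ji}<0}\prod_{t=1}^{-c_{ji}}A_j(u-d_{ij}-td_j)$ for all $i$. The truncated shifted Yangian $Y^{\mathbf r}_\mu(\mathfrak g)$ is the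 quotient of $Y_\mu(\mathfrak g)$ by the two-sided ideal generated by the coefficients of $\langle A_i(u)\rangle_+$, where $\langle\sum_pf_pu^{-p-1}\rangle_+=\sum_{p\ge0}f_pu^{-p-1}$. *)

(* Defs.v *)
From HB Require Import structures.
From mathcomp Require Import all_boot all_order all_algebra.
From mathcomp Require Import finmap complex.
From mathcomp Require Import reals.
Set Implicit Arguments. Unset Strict Implicit. Unset Printing Implicit Defensive.
Import Order.TTheory GRing.Theory Num.Theory.
Local Open Scope ring_scope.

(* Nodes I = 'I_n, Cartan matrix c i j = <alpha_i^vee, alpha_j>,       *)
(* d i = (alpha_i,alpha_i)/2 (coprime positive integers).              *)
Definition simple_cartan_data (n : nat) (c : 'I_n -> 'I_n -> int)
    (d : 'I_n -> nat) : Prop :=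
  (0 < n)%N /\
      (forall i, c i i = 2) /\
      (forall i j, i != j -> c i j <= 0) /\
      (forall i j, (0 < d i)%N /\ (d i)%:Z * c i j = (d j)%:Z * c j i) /\
      \big[gcdn/0%N]_(i < n) d i = 1%N /\
      (* finite type: the symmetrized Cartan matrix (alpha_i,alpha_j) is
         positive definite *)
      (forall x : 'I_n -> rat, (exists i, x i != 0) ->
         0 < \sum_(i < n) \sum_(j < n) x i * ((d i)%:Z * c i j)%:~R * x j) /\
      (* indecomposable (g simple): the Dynkin diagram is connected *)
      (forall S : {set 'I_n}, S != set0 -> S != setT ->
         exists i j, [/\ i \in S, j \notin S & c i j != 0]).

Section Yangian.
Variable R : realType.
Local Notation C := R[i].

Definition gbin (z : int) (j : nat) : C :=
  (\prod_(k < j) (z%:~R - k%:R)) / (j`!)%:R.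

(* Laurent series in u^{-1}: a pair (D, f) stands for                  *)
(*        sum_{k >= 0} f k * u^(D - k).                                *)
Section Series.
Variable T : lalgType C.

Definition ser := (int * (nat -> T))%type.

Definition scoef (F : ser) (p : int) : T :=
  if (0 <= F.1 - p) then F.2 `|F.1 - p|%N else 0.

Definition ser_eq (F G : ser) : Prop := forall p : int, scoef F p = scoef G p.

Definition ser_one : ser := (0, fun k => (k == 0)%:R).

Definition ser_mul (F G : ser) : ser :=
  (F.1 + G.1, fun k => \sum_(l < k.+1) F.2 l * G.2 (k - l)%N).

Definition ser_prod (s : seq ser) : ser := foldr ser_mul ser_one s.

(* F(u - a) *)
Definition ser_shift (F : ser) (a : C) : ser :=
  (F.1, fun t => \sum_(k < t.+1)
          (gbin (F.1 - k%:Z) (t - k)%N * (- a) ^+ (t - k)%N) *: F.2 k).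

(* (u - a)^z *)
Definition ser_linpow (a : C) (z : int) : ser :=
  (z, fun j => (gbin z j * (- a) ^+ j)%:A).

End Series.

(* Elements of the group R generated by the Psi_{i,a}:
   e i = prod_a (u - a)^(e i a), a finitely supported function. *)
Definition rgrp (n : nat) := {ffun 'I_n -> {fsfun C -> int with 0}}.

Definition rgrp_ser (T : lalgType C) n (e : rgrp n) (i : 'I_n) : ser T :=
  ser_prod [seq ser_linpow T a (e i a) | a <- finsupp (e i)].

(* coweight  varpi^vee(e) = sum_i k_i varpi_i^vee,  k_i = deg e_i *)
Definition rgrp_coweight n (e : rgrp n) (i : 'I_n) : int :=
  \sum_(a <- finsupp (e i)) e i a.

Section Relations.
Variables (n : nat) (c : 'I_n -> 'I_n -> int) (d : 'I_n -> nat).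

(* d_ij = (alpha_i, alpha_j)/2 *)
Definition dd (i j : 'I_n) : C := ((d i)%:Z * c i j)%:~R / 2%:R.

Variable A : algType C.

Definition comm (a b : A) := a * b - b * a.

Definition ad_iter (a : A) (k : nat) (b : A) : A := iter k (comm a) b.

Definition sgn (s : bool) : C := if s then 1 else -1.

(* x s i m  stands for x^+_{i,m} (s = true) or x^-_{i,m} (s = false);
   xi i p  stands for xi_{i,p};  mu i = <mu, alpha_i>. *)
Definition yangian_rels (mu : 'I_n -> int)
    (x : bool -> 'I_n -> nat -> A) (xi : 'I_n -> int -> A) : Prop :=
  (forall i j p q, xi i p * xi j q = xi j q * xi i p) /\
      (forall i j m k, comm (x true i m) (x false j k)
                        = if i == j then xi i (m%:Z + k%:Z) else 0) /\
      (forall s i j (p : int) (k : nat),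
         comm (xi i (p + 1)) (x s j k) - comm (xi i p) (x s j k.+1)
         = (sgn s * dd i j) *: (xi i p * x s j k + x s j k * xi i p)) /\
      (forall s i j (m k : nat),
         comm (x s i m.+1) (x s j k) - comm (x s i m) (x s j k.+1)
         = (sgn s * dd i j) *: (x s i m * x s j k + x s j k * x s i m)) /\
      (forall s i j, i != j -> ad_iter (x s i 0) `|1 - c i j|%N (x s j 0) = 0) /\
      (forall i, xi i (- mu i - 1) = 1) /\
      (forall i p, p < - mu i - 1 -> xi i p = 0).

Inductive in_xi_alg (xi : 'I_n -> int -> A) : A -> Prop :=
  | xa_gen j p : in_xi_alg xi (xi j p)
  | xa_one : in_xi_alg xi 1
  | xa_add a b : in_xi_alg xi a -> in_xi_alg xi b -> in_xi_alg xi (a + b)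
  | xa_mul a b : in_xi_alg xi a -> in_xi_alg xi b -> in_xi_alg xi (a * b)
  | xa_scale (k : C) a : in_xi_alg xi a -> in_xi_alg xi (k *: a).

Definition xi_ser (mu : 'I_n -> int) (xi : 'I_n -> int -> A) (i : 'I_n) : ser A :=
  (mu i, fun k => xi i (k%:Z - mu i - 1)).

(* GKLO series: Aco i k is the coefficient of u^(m i - k) in A_i(u);
   the defining identity
     xi_i(u) = r_i(u) / (A_i(u) A_i(u-d_i)) * prod_{j : c_ji < 0}
                 prod_{t=1}^{-c_ji} A_j(u - d_ij - t d_j)
   is written with the (invertible) denominator cleared. *)
Definition gklo_series (mu : 'I_n -> int) (r : rgrp n) (m : 'I_n -> nat)
    (xi : 'I_n -> int -> A) (Aco : 'I_n -> nat -> A) : Prop :=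
  [/\ (forall i k, in_xi_alg xi (Aco i k)),
      (forall i, Aco i 0%N = 1) &
      (forall i,
        let Aser := fun j => ((m j)%:Z, Aco j) : ser A in
        ser_eq
          (ser_mul (ser_mul (xi_ser mu xi i) (Aser i))
                   (ser_shift (Aser i) (d i)%:R))
          (ser_mul (rgrp_ser A r i)
             (ser_prod (flatten
                [seq [seq ser_shift (Aser j) (dd i j + t%:R * (d j)%:R)
                     | t <- iota 1 `|c j i|]
                | j <- enum 'I_n & c j i < 0]))))].

End Relations.

(* V (a module over A, through which Y_mu acts via x, xi) is the irreducible
   highest weight module L(e) with highest weight vector v, and it
   factors through the truncated shifted Yangian Y^r_mu. *)
Definition factors_through_truncation (n : nat) (c : 'I_n -> 'I_n -> int)
    (d : 'I_n -> nat) (mu : 'I_n -> int) (r : rgrp n) (m : 'I_n -> nat)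
    (e : rgrp n) : Prop :=
  exists (A : algType C) (V : lmodType A)
         (x : bool -> 'I_n -> nat -> A) (xi : 'I_n -> int -> A) (v : V),
  yangian_rels c d mu x xi /\
      v != 0 /\
      (forall i k, x true i k *: v = 0) /\
      (forall i p, xi i p *: v = scoef (rgrp_ser A e i) (- p - 1) *: v) /\
      (forall W : V -> Prop,
         W 0 -> (forall w1 w2, W w1 -> W w2 -> W (w1 + w2)) ->
         (forall (k : C) w, W w -> W (k%:A *: w)) ->
         (forall s i k w, W w -> W (x s i k *: w)) ->
         (forall i p w, W w -> W (xi i p *: w)) ->
         (forall w, W w) \/ (forall w, W w -> w = 0)) /\
      (* the coefficients of <A_i(u)>_+ act by zero on V *)
      (forall Aco : 'I_n -> nat -> A, gklo_series c d mu r m xi Aco ->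
         forall i (k : nat), (m i < k)%N -> forall w : V, Aco i k *: w = 0).

End Yangian.

(* Main.v *)
Require Import Defs.
From HB Require Import structures.
From mathcomp Require Import all_boot all_order all_algebra.
From mathcomp Require Import finmap complex.
From mathcomp Require Import reals.
From mathcomp Require boolp.
From mathcomp Require Import zify ring.
Import Order.TTheory GRing.Theory Num.Theory.
Local Open Scope ring_scope.
Set Implicit Arguments. Unset Strict Implicit. Unset Printing Implicit Defensive.

(** On the highest weight vector [v] the GKLO series [A_i(u)] acts by a scalar
    series, and truncation makes it a polynomial [p_i(u)] of degree [m_i].  On the
    vectors [x^-_{i,k} v], identified with [z^k], the series [xi_j(u)] acts as
    multiplication by [e_j(u) (u - z - d_ji) / (u - z + d_ji)], so by uniqueness of
    the GKLO series [A_i(u)] acts as multiplication by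
    [p_i(u) (1 + d_i / (u - z))].  Truncation on [x^-_{i,0} v], followed by
    [x^+_{i,0}], shows that [p_i(u) e_i(u)] is a polynomial.  Inserting this in the
    GKLO relation, [p_i(u - d_i)] divides the numerator of
    [r_i(u) prod_j prod_t p_j(u - d_ij - t d_j)]: if [b] is a root of [p_i], then
    either [b + d_i] is a zero of [r_i], or [b + d_i - d_ij - t d_j] is a root of
    some [p_j].  The quantity [b + d_i / 2] strictly increases along such a step
    because [(alpha_i + alpha_j, alpha_i + alpha_j) > 0], so after at most
    [sum_j m_j] steps one meets a zero of [r].  Hence the roots of all the [p_i]
    lie in a finite set independent of [e], and the [p_i] determine [e]. *)

Local Notation "F ** G" := (ser_mul F G) (at level 40, left associativity).

(** * Laurent series as a commutative monoid *)

Section Binomial.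
Variable R : realType.
Local Notation C := R[i].
Local Notation gbin := (@gbin R).

Lemma gbin0 (z : int) : gbin z 0 = 1.
Proof. by rewrite /gbin big_ord0 fact0 divr1. Qed.

Lemma gbin0n (j : nat) : gbin 0 j = (j == 0%N)%:R.
Proof.
case: j => [|j]; first by rewrite gbin0.
by rewrite /gbin big_ord_recl /= subrr mul0r mul0r.
Qed.

Lemma gbin_neq0_den (j : nat) : j`!%:R != 0 :> C.
Proof. by rewrite pnatr_eq0 -lt0n fact_gt0. Qed.

Lemma gbin_pascal (z : int) (j : nat) : gbin (z + 1) j.+1 = gbin z j.+1 + gbin z j.
Proof.
have f0 := gbin_neq0_den j; have f1 := gbin_neq0_den j.+1.
rewrite /gbin big_ord_recl /= [in RHS]big_ord_recr /=.
have -> : \prod_(k < j) ((z + 1)%:~R - (bump 0 k)%:R) = \prod_(k < j) (z%:~R - k%:R) :> C.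
  apply: eq_bigr => k _; rewrite rmorphD /= /bump /= add1n -[k.+1%:R]natr1.
  ring.
set P := \prod_(k < j) _.
rewrite subr0 rmorphD /= factS natrM -[j.+1%:R]natr1.
rewrite factS natrM -[j.+1%:R]natr1 mulf_eq0 negb_or in f1; case/andP: f1 => f1 _.
by field; rewrite f0 f1.
Qed.

(** As functions of [x], both sides satisfy Pascal's rule and agree at [x = 0]. Going down to
    negative [x] solves the rule for the smaller argument, hence the inner induction on [t]. *)
Lemma gbin_vandermonde (x y : int) (t : nat) :
  gbin (x + y) t = \sum_(s < t.+1) gbin x s * gbin y (t - s).
Proof.
set V := fun x t => \sum_(s < t.+1) gbin x s * gbin y (t - s).
have V0 z : V z 0%N = 1 by rewrite /V big_ord1 !gbin0 mulr1.
have VS z u : V (z + 1) u.+1 = V z u.+1 + V z u.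
  rewrite /V big_ord_recl [in RHS]big_ord_recl !gbin0 !mul1r -addrA; congr (_ + _).
  rewrite -big_split /=; apply: eq_bigr => k _.
  by rewrite /bump /= add1n gbin_pascal mulrDl subSS.
rewrite -/(V x t); elim/int_rect: x t => [|k IH|k IH] t.
- rewrite add0r /V big_ord_recl gbin0 mul1r subn0 big1 ?addr0 // => i _.
  by rewrite gbin0n /= mul0r.
- case: t => [|t]; first by rewrite gbin0 V0.
  by rewrite -addn1 PoszD VS -!IH addrAC gbin_pascal.
- elim: t => [|t IHt]; first by rewrite gbin0 V0.
  have e : - (k.+1)%:Z + 1 = - k%:Z by lia.
  have := VS (- (k.+1)%:Z) t; rewrite e -IH -IHt -e addrAC gbin_pascal.
  by move/addIr.
Qed.

Lemma gbin_nat (k j : nat) : gbin k%:Z j = 'C(k, j)%:R.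
Proof.
elim: k j => [|k IH] [|j]; rewrite ?gbin0 ?bin0 //; first by rewrite gbin0n bin0n.
by rewrite -addn1 PoszD gbin_pascal !IH addn1 binS natrD.
Qed.

End Binomial.

Lemma sum_triangle (V : nmodType) (H : nat -> nat -> V) (n : nat) :
  \sum_(k < n) \sum_(l < k.+1) H l (k - l)%N = \sum_(l < n) \sum_(q < n - l) H l q.
Proof.
elim: n => [|n IH]; first by rewrite !big_ord0.
rewrite big_ord_recr /= IH [RHS]big_ord_recr /= subSnn big_ord1.
rewrite (big_ord_recr n) /= subnn addrA; congr (_ + _).
rewrite -big_split /=; apply: eq_bigr => l _.
by rewrite subSn ?(ltnW (ltn_ord l)) // big_ord_recr.
Qed.

Section SeriesMonoid.
Variables (R : realType) (T : comAlgType R[i]).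
Local Notation C := R[i].
Implicit Types F G H : ser T.

(** Order [k] of a Cauchy product involves only orders up to [k], so ring identities for series are
    inherited from truncated polynomials. *)
Definition trunc (N : nat) (f : nat -> T) : {poly T} := \poly_(k < N) f k.

Lemma coef_trunc_mul N (f g : nat -> T) k : (k < N)%N ->
  (trunc N f * trunc N g)`_k = \sum_(l < k.+1) f l * g (k - l)%N.
Proof.
move=> kN; rewrite coefM; apply: eq_bigr => l _.
have lk := ltn_ord l.
by rewrite !coef_poly !ifT //; lia.
Qed.

Lemma coef_trunc N (f : nat -> T) k : (k < N)%N -> (trunc N f)`_k = f k.
Proof. by move=> kN; rewrite coef_poly kN. Qed.

Lemma serP F G : F.1 = G.1 -> F.2 =1 G.2 -> F = G.
Proof. by case: F G => [x f] [y g] /= -> /boolp.funext ->. Qed.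

Lemma ser_mulA : associative (@ser_mul R T).
Proof.
move=> F G H; apply: serP => [|t] /=; first by rewrite addrA.
transitivity ((trunc t.+1 F.2 * (trunc t.+1 G.2 * trunc t.+1 H.2))`_t); last rewrite mulrA.
  rewrite coefM; apply: eq_bigr => l _.
  rewrite coef_trunc // coef_trunc_mul //; have := ltn_ord l; lia.
rewrite coefM; apply: eq_bigr => l _.
rewrite coef_trunc_mul // coef_trunc //; have := ltn_ord l; lia.
Qed.

Lemma ser_mulC : commutative (@ser_mul R T).
Proof.
move=> F G; apply: serP => [|t] /=; first by rewrite addrC.
by rewrite -(@coef_trunc_mul t.+1) // mulrC coef_trunc_mul.
Qed.

Lemma ser_mul1 : left_id (@ser_one R T) (@ser_mul R T).
Proof.
move=> F; apply: serP => [|t] /=; first by rewrite add0r.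
rewrite big_ord_recl /= mul1r subn0 big1 ?addr0 // => i _.
by rewrite /= mul0r.
Qed.

HB.instance Definition _ :=
  Monoid.isComLaw.Build (ser T) (@ser_one R T) (@ser_mul R T)
    ser_mulA ser_mulC ser_mul1.

Lemma ser_prodE (s : seq (ser T)) :
  ser_prod s = \big[@ser_mul R T/@ser_one R T]_(F <- s) F.
Proof. by elim: s => [|F s IH]; rewrite ?big_nil //= big_cons IH. Qed.

Lemma ser_mul_cancel F G H : F.2 0%N = 1 -> ser_mul F G = ser_mul F H -> G = H.
Proof.
move=> F0 [e1 e2]; apply: serP => [|k]; first exact: (addrI F.1).
elim/ltn_ind: k => k IH.
have := congr1 (fun f => f k) e2; rewrite !big_ord_recl F0 !mul1r subn0.
rewrite [X in _ + X](@eq_bigr _ _ _ _ _ _ _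
  (fun i : 'I_k => F.2 (lift ord0 i) * H.2 (k - lift ord0 i)%N)); first by move/addIr.
move=> i _; rewrite IH // /lift /= /bump /=; have := ltn_ord i; lia.
Qed.

Lemma ser_mul_lead F G : F.2 0%N = 1 -> G.2 0%N = 1 -> (ser_mul F G).2 0%N = 1.
Proof. by move=> F0 G0; rewrite /= big_ord1 F0 G0 mulr1. Qed.

Lemma ser_shift_lead F a : (ser_shift F a).2 0%N = F.2 0%N.
Proof. by rewrite /= big_ord1 gbin0 expr0 mul1r scale1r. Qed.

Definition linpow_trunc (N : nat) (z : int) (a : C) : {poly T} :=
  trunc N (ser_linpow T a z).2.

Lemma linpow_vandermonde (a : C) (x y : int) (t : nat) :
  \sum_(s < t.+1) (ser_linpow T a x).2 s * (ser_linpow T a y).2 (t - s)%N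
  = (ser_linpow T a (x + y)).2 t.
Proof.
rewrite /= gbin_vandermonde mulr_suml scaler_suml; apply: eq_bigr => s _.
rewrite -scalerAl mul1r scalerA; congr (_ *: _).
have -> : (- a) ^+ t = (- a) ^+ s * (- a) ^+ (t - s).
  by rewrite -exprD subnKC // -ltnS.
by rewrite mulrACA.
Qed.

Lemma ser_linpowD (a : C) (x y : int) :
  ser_mul (ser_linpow T a x) (ser_linpow T a y) = ser_linpow T a (x + y).
Proof. by apply: serP => // t; exact: linpow_vandermonde. Qed.

Lemma ser_linpow0 (a : C) : ser_linpow T a 0 = ser_one T.
Proof.
apply: serP => // [] [|j] /=; first by rewrite gbin0 mul1r scale1r.
by rewrite gbin0n /= mul0r scale0r.
Qed.

(** With [X] for the inverse of [u], the shift of the monomial of order [l] contributes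
    [X^l (1 - a X)^(D - l)], where [D] is the degree of [F]. *)
Lemma ser_shift_coefE N F a s : (s < N)%N ->
  (ser_shift F a).2 s
  = (\sum_(l < N) (F.2 l)%:P * 'X^l * linpow_trunc N (F.1 - l%:Z) a)`_s.
Proof.
move=> sN; rewrite coef_sum /=.
rewrite (big_ord_widen N (fun k => (gbin R (F.1 - k%:Z) (s - k) * (- a) ^+ (s - k)) *: F.2 k)) //.
rewrite [RHS](bigID (fun l : 'I_N => (l < s.+1)%N)) /= [X in _ + X]big1 ?addr0.
  apply: eq_bigr => l ls; rewrite -mulrA coefCM coefXnM ltnNge -ltnS ls /=.
  by rewrite coef_trunc ?mulr_algr //; lia.
move=> l ls; rewrite -mulrA coefCM coefXnM ifT ?mulr0 //; lia.
Qed.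

Lemma ser_shiftM F G a :
  ser_shift (ser_mul F G) a = ser_mul (ser_shift F a) (ser_shift G a).
Proof.
apply: serP => // t; set N := t.+1.
pose S (F : ser T) := \sum_(l < N) (F.2 l)%:P * 'X^l * linpow_trunc N (F.1 - l%:Z) a.
(* [H l q] is the contribution to order [t] of the monomials of orders [l] and [q]; both sides sum
   it over [l + q <= t]. *)
pose H l q := (ser_linpow T a (F.1 + G.1 - (l + q)%:Z)).2 (t - (l + q))%N * (F.2 l * G.2 q).
have -> : (ser_mul (ser_shift F a) (ser_shift G a)).2 t = (S F * S G)`_t.
  rewrite coefM; apply: eq_bigr => l _; rewrite !(@ser_shift_coefE N) //.
  by rewrite /N ltnS leq_subr.
have -> : (ser_shift (ser_mul F G) a).2 t = \sum_(k < N) \sum_(l < k.+1) H l (k - l)%N.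
  apply: eq_bigr => k _; rewrite /= scaler_sumr; apply: eq_bigr => l _.
  rewrite /H /= subnKC; last by rewrite -ltnS.
  by rewrite mulr_algl.
rewrite sum_triangle /S big_distrlr /= coef_sum; apply: eq_bigr => l _.
rewrite coef_sum (big_ord_widen N (H l)) ?leq_subr //.
rewrite [RHS](bigID (fun q : 'I_N => (q < N - l)%N)) /= [X in _ + X]big1 ?addr0.
  apply: eq_bigr => q ql.
  have -> : (F.2 l)%:P * 'X^l * linpow_trunc N (F.1 - l%:Z) a *
     ((G.2 q)%:P * 'X^q * linpow_trunc N (G.1 - q%:Z) a) =
     (F.2 l * G.2 q)%:P * ('X^(l + q) * (linpow_trunc N (F.1 - l%:Z) a * linpow_trunc N (G.1 - q%:Z) a)).
    by rewrite polyCM exprD; ring.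
  rewrite coefCM coefXnM ifF; last by lia.
  rewrite coef_trunc_mul; last by lia.
  rewrite linpow_vandermonde /H mulrC; congr (_ * _ ).
  rewrite (_ : F.1 - l%:Z + (G.1 - q%:Z) = F.1 + G.1 - (l + q)%:Z); last by lia.
  by rewrite subnDA subnAC -subnDA.
move=> q ql.
have -> : (F.2 l)%:P * 'X^l * linpow_trunc N (F.1 - l%:Z) a *
     ((G.2 q)%:P * 'X^q * linpow_trunc N (G.1 - q%:Z) a) =
     (F.2 l * G.2 q)%:P * ('X^(l + q) * (linpow_trunc N (F.1 - l%:Z) a * linpow_trunc N (G.1 - q%:Z) a)).
    by rewrite polyCM exprD; ring.
rewrite coefCM coefXnM ifT ?mulr0 //; lia.
Qed.

Lemma ser_shift_one a : ser_shift (ser_one T) a = ser_one T.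
Proof.
apply: serP => // t /=; rewrite big_ord_recl /= big1 ?addr0 => [|k _].
  rewrite subn0 gbin0n.
  by case: t => [|t] /=; rewrite ?expr0 ?mul1r ?scale1r // mul0r scale0r.
by rewrite scaler0.
Qed.

Lemma ser_shift_prod a (I : Type) (s : seq I) (P : pred I) (f : I -> ser T) :
  ser_shift (\big[@ser_mul R T/@ser_one R T]_(i <- s | P i) f i) a
  = \big[@ser_mul R T/@ser_one R T]_(i <- s | P i) ser_shift (f i) a.
Proof.
apply: (big_morph (fun F => ser_shift F a)) => [F G|]; first exact: ser_shiftM.
exact: ser_shift_one.
Qed.

Lemma ser_prod_lead (I : Type) (s : seq I) (P : pred I) (f : I -> ser T) :
  (forall i, P i -> (f i).2 0%N = 1) ->
  (\big[@ser_mul R T/@ser_one R T]_(i <- s | P i) f i).2 0%N = 1.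
Proof.
move=> h; apply: (big_ind (fun F : ser T => F.2 0%N = 1)) => //.
by move=> F G; exact: ser_mul_lead.
Qed.

End SeriesMonoid.

(** * The GKLO recursion *)

Section Gklo.
Variables (R : realType) (n : nat) (c : 'I_n -> 'I_n -> int) (d : 'I_n -> nat).
Variables (mu : 'I_n -> int) (r : rgrp R n) (m : 'I_n -> nat).
Local Notation C := R[i].

Definition gklo_pairs (i : 'I_n) : seq ('I_n * nat) :=
  [seq (j, t) | j <- [seq j <- enum 'I_n | c j i < 0], t <- iota 1 `|c j i|].

Definition gklo_arg (i : 'I_n) (p : 'I_n * nat) : C :=
  dd R c d i p.1 + p.2%:R * (d p.1)%:R.

Lemma sum_gklo_pairs (V : nmodType) i (x : 'I_n -> V) :
  \sum_(p <- gklo_pairs i) x p.1 = \sum_(j | c j i < 0) x j *+ `|c j i|.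
Proof.
rewrite big_allpairs_dep /= big_filter big_enum_cond /=; apply: eq_bigr => j _.
by rewrite big_const_seq count_predT size_iota iter_addr_0.
Qed.

Lemma sum_cartan_split (V : zmodType) (x : 'I_n -> V) i :
  (forall i, c i i = 2) -> (forall i j, i != j -> c i j <= 0) ->
  \sum_j x j *~ c j i = x i *+ 2 - \sum_(j | c j i < 0) x j *+ `|c j i|.
Proof.
move=> c_diag c_off; rewrite (bigD1 i) //= c_diag; congr (_ + _).
rewrite (bigID (fun j => c j i < 0)) /= [X in _ + X]big1 ?addr0; last first.
  move=> j /andP[ji]; rewrite -leNgt => h.
  by have := c_off _ _ ji; rewrite le_eqVlt ltNge h orbF => /eqP->.
rewrite -sumrN; apply: eq_big => [j|j /andP[_ h]].
  by case: eqP => //= ->; rewrite c_diag.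
rewrite {1}(_ : c j i = - (`|c j i|%N)%:Z); last by lia.
by rewrite mulrNz -pmulrn.
Qed.

Section Equation.
Variable T : lalgType C.
Implicit Types (Xi a : 'I_n -> nat -> T).

Definition gklo_lhs Xi a (i : 'I_n) : ser T :=
  ser_mul (ser_mul (mu i, Xi i) ((m i)%:Z, a i))
          (ser_shift ((m i)%:Z, a i) (d i)%:R).

Definition gklo_rhs a (i : 'I_n) : ser T :=
  ser_mul (rgrp_ser T r i)
    (ser_prod [seq ser_shift ((m p.1)%:Z, a p.1) (gklo_arg i p) | p <- gklo_pairs i]).

Lemma gklo_flatten (f : 'I_n * nat -> ser T) i :
  flatten [seq [seq f (j, t) | t <- iota 1 `|c j i|] | j <- enum 'I_n & c j i < 0]
  = [seq f p | p <- gklo_pairs i].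
Proof.
rewrite /gklo_pairs map_flatten -map_comp; congr flatten.
by apply: eq_map => j /=; rewrite -map_comp.
Qed.

(** Compares coefficients by distance from the leading term; equality of the leading degrees is the
    separate lemma [gklo_deg]. *)
Definition gklo_defect Xi a i k : T := (gklo_lhs Xi a i).2 k - (gklo_rhs a i).2 k.

(** First-order calculus: up to order [k], [F] is [G] times [1 + x u^-k]. As leading coefficients
    are 1, [x] behaves like a logarithmic derivative, additive under products and unchanged by
    shifts. *)
Definition perturbed (k : nat) (F G : ser T) (x : T) : Prop :=
  [/\ F.1 = G.1, F.2 0%N = 1, G.2 0%N = 1,
      forall l, (l < k)%N -> F.2 l = G.2 l & F.2 k = G.2 k + x].

Lemma perturbed_refl k F : F.2 0%N = 1 -> perturbed k F F 0.
Proof. by move=> F0; split=> //; rewrite addr0. Qed.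

Lemma perturbed_mul k F G F' G' x y : (0 < k)%N ->
  perturbed k F F' x -> perturbed k G G' y ->
  perturbed k (ser_mul F G) (ser_mul F' G') (x + y).
Proof.
case: k => // k _ [dF F0 F0' eF kF] [dG G0 G0' eG kG]; split=> /=.
- by rewrite dF dG.
- by rewrite big_ord1 F0 G0 mulr1.
- by rewrite big_ord1 F0' G0' mulr1.
- move=> l lk; apply: eq_bigr => s _; have sl := ltn_ord s.
  by rewrite eF ?eG //; lia.
- rewrite big_ord_recl big_ord_recr [in RHS]big_ord_recl [in RHS]big_ord_recr /=.
  rewrite F0 F0' !mul1r subn0 /bump /= add1n subnn G0 G0' !mulr1 kG kF.
  under eq_bigr => s _.
    rewrite eF ?eG /bump /=; first over.
    - by lia.
    - by have := ltn_ord s; lia.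
  set S := \sum_(s < k) _.
  by rewrite -!addrA; congr (_ + _); rewrite addrC -!addrA.
Qed.

Lemma perturbed_shift k F G x (b : C) :
  perturbed k F G x -> perturbed k (ser_shift F b) (ser_shift G b) x.
Proof.
case=> dF F0 G0 eF kF; split=> //=.
- by rewrite big_ord1 gbin0 expr0 mul1r scale1r.
- by rewrite big_ord1 gbin0 expr0 mul1r scale1r.
- move=> l lk; apply: eq_bigr => s _; rewrite dF eF //.
  by have := ltn_ord s; lia.
- rewrite !big_ord_recr /= subnn !gbin0 expr0 mul1r !scale1r kF addrA.
  by congr (_ + _ + _); apply: eq_bigr => s _; rewrite dF eF.
Qed.

Lemma perturbed_prod k (I : Type) (f g : I -> ser T) (x : I -> T) (s : seq I) :
  (0 < k)%N -> (forall i, perturbed k (f i) (g i) (x i)) ->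
  perturbed k (ser_prod [seq f i | i <- s]) (ser_prod [seq g i | i <- s])
    (\sum_(i <- s) x i).
Proof.
move=> k0 h; elim: s => [|i s IH] /=; first by rewrite big_nil; exact: perturbed_refl.
by rewrite big_cons; exact: perturbed_mul.
Qed.

Lemma rgrp_ser_lead (e : rgrp R n) i : (rgrp_ser T e i).2 0%N = 1.
Proof.
rewrite /rgrp_ser; elim: (enum_fset _) => //= a s IH.
by rewrite big_ord1 IH mulr1 gbin0 mul1r scale1r.
Qed.

Lemma gklo_lhs_perturbed Xi a b (x : 'I_n -> T) k i : (0 < k)%N ->
  Xi i 0%N = 1 ->
  (forall j, perturbed k ((m j)%:Z, a j) ((m j)%:Z, b j) (x j)) ->
  perturbed k (gklo_lhs Xi a i) (gklo_lhs Xi b i) (x i *+ 2).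
Proof.
move=> k0 X0 h; rewrite mulr2n -[x i + x i in X in perturbed _ _ _ X]add0r addrA.
apply: perturbed_mul => //; last exact: perturbed_shift.
by apply: perturbed_mul => //; exact: perturbed_refl.
Qed.

Lemma gklo_rhs_perturbed a b (x : 'I_n -> T) k i : (0 < k)%N ->
  (forall j, perturbed k ((m j)%:Z, a j) ((m j)%:Z, b j) (x j)) ->
  perturbed k (gklo_rhs a i) (gklo_rhs b i) (\sum_(j | c j i < 0) x j *+ `|c j i|).
Proof.
move=> k0 h; rewrite -[X in perturbed _ _ _ X]add0r -sum_gklo_pairs.
apply: perturbed_mul => //; first by apply: perturbed_refl; exact: rgrp_ser_lead.
by apply: perturbed_prod => // p; exact: perturbed_shift.
Qed.

Hypothesis c_diag : forall i, c i i = 2.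
Hypothesis c_off : forall i j, i != j -> c i j <= 0.

(** [A_i] occurs twice on the left and each neighbouring [A_j] occurs [-c_ji] times on the right, so
    the increments combine to the transposed Cartan matrix. *)
Lemma gklo_defect_perturbed Xi a b (x : 'I_n -> T) k i : (0 < k)%N ->
  Xi i 0%N = 1 ->
  (forall j, perturbed k ((m j)%:Z, a j) ((m j)%:Z, b j) (x j)) ->
  gklo_defect Xi a i k = gklo_defect Xi b i k + \sum_j (c j i)%:~R *: x j.
Proof.
move=> k0 X0 h; rewrite /gklo_defect.
under [X in _ = _ + X]eq_bigr => j _ do rewrite scaler_int.
rewrite sum_cartan_split //.
have [_ _ _ _ ->] := gklo_lhs_perturbed k0 X0 h.
have [_ _ _ _ ->] := gklo_rhs_perturbed i k0 h.
by rewrite opprD addrACA.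
Qed.

Variable N : 'M[C]_n.
Hypothesis NC : forall i j, \sum_k N i k * (c k j)%:~R = (i == j)%:R.
Hypothesis CN : forall i j, \sum_k (c i k)%:~R * N k j = (i == j)%:R.

(* Changing the coefficients of order k of the unknown series, with the lower ones
   fixed, changes the defect of order k by the transposed Cartan matrix; one step
   corrects it with the inverse N of that matrix. *)
Definition gklo_newton Xi a j k : T := a j k - \sum_i N i j *: gklo_defect Xi a i k.

Definition gklo_iter Xi k : 'I_n -> nat -> T :=
  iter k (gklo_newton Xi) (fun _ l => (l == 0%N)%:R).

(** Later steps leave the coefficient of order [k] fixed, so the diagonal is the limit of the
    iteration. *)
Definition gklo_sol Xi j k : T := gklo_iter Xi k j k.

Lemma gklo_defect0 Xi a i : Xi i 0%N = 1 -> (forall j, a j 0%N = 1) ->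
  gklo_defect Xi a i 0%N = 0.
Proof.
move=> X0 a0; rewrite /gklo_defect.
have -> : (gklo_lhs Xi a i).2 0%N = 1.
  by rewrite /= !big_ord1 /= X0 a0 gbin0 expr0 !mul1r scale1r.
have h j : perturbed 1 ((m j)%:Z, a j) ((m j)%:Z, a j) 0 by apply: perturbed_refl; exact: a0.
by have [_ -> _ _ _] := gklo_rhs_perturbed i (ltn0Sn 0) h; rewrite subrr.
Qed.

Lemma gklo_defect_ext Xi a b i k : Xi i 0%N = 1 -> (forall j, a j 0%N = 1) ->
  (forall j l, (l <= k)%N -> a j l = b j l) ->
  gklo_defect Xi a i k = gklo_defect Xi b i k.
Proof.
move=> X0 a0 e; have b0 j : b j 0%N = 1 by rewrite -e.
case: (posnP k) => [->|k0]; first by rewrite !gklo_defect0.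
have h j : perturbed k ((m j)%:Z, a j) ((m j)%:Z, b j) 0.
  by split=> //= [l lk|]; rewrite ?addr0 e // ltnW.
rewrite (gklo_defect_perturbed k0 X0 h) big1 ?addr0 // => j _.
by rewrite scaler0.
Qed.

Lemma cartan_inv (y : 'I_n -> T) i :
  \sum_j (c j i)%:~R *: (\sum_i' N i' j *: y i') = y i.
Proof.
under eq_bigr => j _ do rewrite scaler_sumr.
rewrite exchange_big /=.
under eq_bigr => i' _.
  under eq_bigr => j _ do rewrite scalerA mulrC.
  rewrite -scaler_suml NC; over.
rewrite (bigD1 i) //= eqxx scale1r big1 ?addr0 // => j /negbTE->.
by rewrite scale0r.
Qed.

Lemma cartan_inj (x : 'I_n -> T) :
  (forall i, \sum_j (c j i)%:~R *: x j = 0) -> forall j, x j = 0.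
Proof.
move=> h j.
have : \sum_i N i j *: (\sum_k (c k i)%:~R *: x k) = 0.
  by rewrite big1 // => i _; rewrite h scaler0.
under eq_bigr => i _ do rewrite scaler_sumr.
rewrite exchange_big /=.
under eq_bigr => i' _.
  under eq_bigr => k _ do rewrite scalerA mulrC.
  rewrite -scaler_suml CN; over.
rewrite (bigD1 j) //= eqxx scale1r big1 ?addr0 // => k /negbTE->.
by rewrite scale0r.
Qed.

(** A Newton step does not move orders whose defects already vanish, and it cancels the defect of
    the next order. *)
Lemma gklo_iterP Xi k : (forall i, Xi i 0%N = 1) ->
  (forall j, gklo_iter Xi k j 0%N = 1) /\
  (forall i l, (l <= k)%N -> gklo_defect Xi (gklo_iter Xi k) i l = 0).
Proof.
move=> X0; elim: k => [|k [IH0 IH]].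
  by split=> // i [|l] // _; rewrite gklo_defect0.
have h0 j : gklo_iter Xi k.+1 j 0%N = 1.
  rewrite /= /gklo_newton -/(gklo_iter Xi k) IH0 big1 ?subr0 // => i _.
  by rewrite IH // scaler0.
have agr j l : (l <= k)%N -> gklo_iter Xi k.+1 j l = gklo_iter Xi k j l.
  move=> lk; rewrite /= /gklo_newton -/(gklo_iter Xi k) big1 ?subr0 // => i _.
  by rewrite IH // scaler0.
split=> // i l; rewrite leq_eqVlt ltnS => /orP[/eqP->|lk]; last first.
  rewrite (@gklo_defect_ext Xi _ (gklo_iter Xi k)) ?IH // => j l' l'l.
  by apply: agr; apply: leq_trans l'l lk.
have h j : perturbed k.+1 ((m j)%:Z, gklo_iter Xi k.+1 j) ((m j)%:Z, gklo_iter Xi k j)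
   (- \sum_i N i j *: gklo_defect Xi (gklo_iter Xi k) i k.+1).
  by split=> //; [exact: h0 | exact: IH0 | move=> l' l'k; exact: agr].
rewrite (gklo_defect_perturbed _ (X0 i) h) //.
under eq_bigr => j _ do rewrite scalerN.
by rewrite sumrN cartan_inv subrr.
Qed.

Lemma gklo_iter_stable Xi k l j : (forall i, Xi i 0%N = 1) -> (l <= k)%N ->
  gklo_iter Xi k j l = gklo_sol Xi j l.
Proof.
move=> X0 /subnKC <-; elim: (k - l)%N => [|q IH]; first by rewrite addn0.
rewrite addnS /= /gklo_newton -/(gklo_iter Xi _) big1 ?subr0 // => i _.
by have [_ ->] := gklo_iterP (l + q) X0; rewrite ?scaler0 // leq_addr.
Qed.

Lemma gklo_sol0 Xi j : gklo_sol Xi j 0%N = 1.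
Proof. by []. Qed.

Lemma gklo_sol_defect Xi i k : (forall i, Xi i 0%N = 1) ->
  gklo_defect Xi (gklo_sol Xi) i k = 0.
Proof.
move=> X0; rewrite (@gklo_defect_ext _ _ (gklo_iter Xi k)) //.
  by have [_ ->] := gklo_iterP k X0.
by move=> j l lk; rewrite gklo_iter_stable.
Qed.

(** At the first order where two solutions could differ, their difference is annihilated by the
    transposed Cartan matrix. *)
Lemma gklo_unique Xi a : (forall i, Xi i 0%N = 1) -> (forall j, a j 0%N = 1) ->
  (forall i k, gklo_defect Xi a i k = 0) -> forall j k, a j k = gklo_sol Xi j k.
Proof.
move=> X0 a0 ha j k; elim/ltn_ind: k j => k IH j.
case: (posnP k) => [->|k0]; first by rewrite a0.
have h i : perturbed k ((m i)%:Z, a i) ((m i)%:Z, gklo_sol Xi i) (a i k - gklo_sol Xi i k).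
  by split=> //= [l lk|]; [exact: IH|rewrite addrC subrK].
apply/eqP; rewrite -subr_eq0; apply/eqP.
apply: (cartan_inj (x := fun j => a j k - gklo_sol Xi j k)) => i.
have := gklo_defect_perturbed k0 (X0 i) h.
by rewrite ha gklo_sol_defect // add0r => <-.
Qed.

End Equation.

(* Coefficientwise transport of the GKLO recursion along any relation compatible
   with the algebra operations, such as "a acts on v by the scalar z". *)
Section Naturality.
Variables (T1 T2 : lalgType C) (E : T1 -> T2 -> Prop).
Hypothesis E1 : E 1 1.
Hypothesis ED : forall a b a' b', E a a' -> E b b' -> E (a + b) (a' + b').
Hypothesis EM : forall a b a' b', E a a' -> E b b' -> E (a * b) (a' * b').
Hypothesis EZ : forall (k : C) a a', E a a' -> E (k *: a) (k *: a').

Lemma nat_rel0 : E 0 0.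
Proof. by have := EZ 0 E1; rewrite !scale0r. Qed.

Lemma nat_relN a a' : E a a' -> E (- a) (- a').
Proof. by move=> h; have := EZ (-1) h; rewrite !scaleN1r. Qed.

Lemma nat_rel_sum (I : Type) (s : seq I) (P : pred I) f g :
  (forall i, E (f i) (g i)) -> E (\sum_(i <- s | P i) f i) (\sum_(i <- s | P i) g i).
Proof.
move=> h; apply: (big_ind2 E) => //; first exact: nat_rel0.
by move=> *; exact: ED.
Qed.

Definition ser_rel (F : ser T1) (G : ser T2) := F.1 = G.1 /\ forall k, E (F.2 k) (G.2 k).

Lemma ser_rel_mul F F' G G' : ser_rel F F' -> ser_rel G G' ->
  ser_rel (ser_mul F G) (ser_mul F' G').
Proof.
move=> [dF hF] [dG hG]; split=> [|k] /=; first by rewrite dF dG.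
by apply: nat_rel_sum => l; exact: EM.
Qed.

Lemma ser_rel_shift F F' b : ser_rel F F' -> ser_rel (ser_shift F b) (ser_shift F' b).
Proof.
move=> [dF hF]; split=> // k /=; apply: nat_rel_sum => l; rewrite dF; exact: EZ.
Qed.

Lemma ser_rel_prod (I : Type) (s : seq I) f g :
  (forall i, ser_rel (f i) (g i)) ->
  ser_rel (ser_prod [seq f i | i <- s]) (ser_prod [seq g i | i <- s]).
Proof.
move=> h; elim: s => [|i s IH] /=; last exact: ser_rel_mul.
by split=> // [] [|k] //=; exact: nat_rel0.
Qed.

Lemma ser_rel_rgrp (e : rgrp R n) i : ser_rel (rgrp_ser T1 e i) (rgrp_ser T2 e i).
Proof. by apply: ser_rel_prod => b; split=> //= k; exact: EZ. Qed.

Lemma gklo_defect_rel Xi Xi' a a' :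
  (forall i k, E (Xi i k) (Xi' i k)) -> (forall i k, E (a i k) (a' i k)) ->
  forall i k, E (gklo_defect Xi a i k) (gklo_defect Xi' a' i k).
Proof.
move=> hX ha i k; apply: ED; last apply: nat_relN.
  suff [_ h] : ser_rel (gklo_lhs Xi a i) (gklo_lhs Xi' a' i) by exact: h.
  apply: ser_rel_mul; last by apply: ser_rel_shift; split=> //; exact: ha.
  by apply: ser_rel_mul; split=> //; [exact: hX | exact: ha].
suff [_ h] : ser_rel (gklo_rhs a i) (gklo_rhs a' i) by exact: h.
apply: ser_rel_mul; first exact: ser_rel_rgrp.
by apply: ser_rel_prod => p; apply: ser_rel_shift; split=> //; exact: ha.
Qed.

Lemma gklo_sol_rel N Xi Xi' :
  (forall i k, E (Xi i k) (Xi' i k)) ->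
  forall i k, E (gklo_sol N Xi i k) (gklo_sol N Xi' i k).
Proof.
(* The iteration count and the coefficient index are decoupled, because a Newton step involves
   coefficients of other orders. *)
move=> hX i k; rewrite /gklo_sol; move: {2 4}k => l.
elim: k i l => [|k IH] i l /=; first by case: l => [|l]; [exact: E1 | exact: nat_rel0].
apply: ED; first exact: IH.
apply: nat_relN; apply: nat_rel_sum => j; apply: EZ.
exact: gklo_defect_rel.
Qed.

End Naturality.
End Gklo.

Lemma rgrp_ser_deg (R : realType) (T : lalgType R[i]) n (e : rgrp R n) i :
  (rgrp_ser T e i).1 = rgrp_coweight e i.
Proof.
rewrite /rgrp_ser /rgrp_coweight; elim: (enum_fset _) => [|a s IH].
  by rewrite big_nil.
by rewrite big_cons /= IH.
Qed.

Section GkloDegree.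
Variables (R : realType) (n : nat) (c : 'I_n -> 'I_n -> int) (d : 'I_n -> nat).
Variables (mu : 'I_n -> int) (r : rgrp R n) (m : 'I_n -> nat).
Hypothesis c_diag : forall i, c i i = 2.
Hypothesis c_off : forall i j, i != j -> c i j <= 0.
Hypothesis Htrunc : forall j, rgrp_coweight r j - mu j = \sum_(i < n) (m i)%:Z * c i j.
Variable T : lalgType R[i].

(** Truncatability, pairing the coweight of [r] minus [mu] with each simple root, is exactly the
    balance of degrees. *)
Lemma gklo_deg (Xi a : 'I_n -> nat -> T) i :
  (gklo_lhs d mu m Xi a i).1 = (gklo_rhs c d r m a i).1.
Proof.
rewrite /= rgrp_ser_deg.
have -> : (ser_prod [seq ser_shift ((m p.1)%:Z, a p.1) (gklo_arg R c d i p)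
    | p <- gklo_pairs c i]).1 = \sum_(p <- gklo_pairs c i) (m p.1)%:Z.
  by elim: (gklo_pairs c i) => [|p s IH]; rewrite ?big_nil // big_cons /= IH.
rewrite (sum_gklo_pairs c i (fun j => (m j)%:Z)).
have := sum_cartan_split (fun j => (m j)%:Z) i c_diag c_off.
under eq_bigr => j _ do rewrite -mulrzr intz.
move=> E; rewrite -[X in _ = X + _](subrK (mu i)) Htrunc E mulr2n.
by set S := \sum_(_ | _) _; lia.
Qed.

Lemma gklo_defect_eq (Xi a : 'I_n -> nat -> T) i :
  (forall k, gklo_defect c d mu r m Xi a i k = 0) ->
  gklo_lhs d mu m Xi a i = gklo_rhs c d r m a i.
Proof.
move=> h; apply/pair_equal_spec; split; first exact: gklo_deg.
by apply: boolp.funext => k; apply/eqP; rewrite -subr_eq0; apply/eqP; exact: h.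
Qed.

End GkloDegree.


(** * GKLO series on the weight spaces next to the highest one *)

Section Generic.
Variables (R : realType).
Local Notation C := R[i].
Local Notation P := {poly C}.

(* The series u - (z + b), where the parameter z is the variable of P. *)
Definition zlin (b : C) : ser P :=
  (1, fun k => if k is k'.+1 then (k' == 0%N)%:R * - ('X + b%:P) else 1).

(* The series 1 + q / (u - z). *)
Definition zfrac (q : C) : ser P :=
  (0, fun k => if k is k'.+1 then q *: 'X^k' else 1).

(** Coefficients of [x(u) (u - z - q) / (u - z + q)], in the recursive form produced by commuting
    [xi] past [x^-]. *)
Fixpoint twist (q : C) (x : nat -> C) (k : nat) : P :=
  if k is k'.+1 then
    ('X - q%:P) * twist q x k' + (x k)%:P - ('X + q%:P) * (x k')%:P
  else (x 0%N)%:P.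

Lemma zlin_mulS b (F : ser P) k :
  (zlin b ** F).2 k.+1 = F.2 k.+1 - ('X + b%:P) * F.2 k.
Proof.
rewrite /= big_ord_recl big_ord_recl big1 => [|i _] /=; last by rewrite mul0r mul0r.
by rewrite addr0 !mul1r subn0 subSS subn0 mulNr.
Qed.

Lemma zlin_mul0 b (F : ser P) : (zlin b ** F).2 0%N = F.2 0%N.
Proof. by rewrite /= big_ord1 mul1r. Qed.

Lemma zlin_frac q : zlin 0 ** zfrac q = zlin (- q).
Proof.
apply: serP => // [] [|k]; first by rewrite zlin_mul0.
rewrite zlin_mulS polyC0 addr0; case: k => [|k] /=.
  by rewrite mulr1 mul1r expr0 polyCN -mul_polyC mulr1; ring.
by rewrite mul0r exprS scalerAr subrr.
Qed.

Lemma zlin_twist q x D :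
  zlin (- q) ** (D, twist q x) = zlin q ** (D, fun k => (x k)%:P).
Proof.
apply: serP => // [] [|k]; first by rewrite !zlin_mul0.
by rewrite !zlin_mulS /= polyCN; ring.
Qed.

Lemma gbin1SS k : gbin R 1 k.+2 = 0.
Proof. by rewrite (gbin_nat R 1) bin_small. Qed.

Lemma zlin_shift b a : ser_shift (zlin b) a = zlin (b + a).
Proof.
apply: serP => // t; rewrite [LHS]/=; case: t => [|t].
  by rewrite big_ord1 gbin0 expr0 mul1r scale1r.
rewrite big_ord_recl big_ord_recl big1 => [|i _]; last by rewrite /= mul0r scaler0.
rewrite addr0 /= subSS !subn0 gbin0n.
case: t => [|t]; last by rewrite gbin1SS !addr0 !mul0r !scale0r addr0.
rewrite (gbin_nat R 1) bin1 eqxx expr1 expr0 !mul1r addr0 scale1r polyCD alg_polyC polyCN.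
ring.
Qed.

Lemma zlin_frac_shift (a q : C) : zlin a ** ser_shift (zfrac q) a = zlin (a - q).
Proof.
have -> : zlin a = ser_shift (zlin 0) a by rewrite zlin_shift add0r.
by rewrite -ser_shiftM zlin_frac zlin_shift addrC.
Qed.

(** The factor of index [t] is the quotient of [zlin (b + (t - 1) q)] by [zlin (b + t q)]. *)
Lemma zlin_frac_telescope (b q : C) (N : nat) :
  zlin (b + N%:R * q) **
    \big[@ser_mul R P/@ser_one R P]_(t <- iota 1 N) ser_shift (zfrac q) (b + t%:R * q)
  = zlin b.
Proof.
elim: N => [|N IH]; first by rewrite big_nil mul0r addr0 Monoid.mulm1.
rewrite -addn1 iotaD big_cat big_seq1 /= add1n addn1.
rewrite [X in _ ** X]ser_mulC ser_mulA zlin_frac_shift.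
by rewrite -[in RHS]IH -natr1 mulrDl mul1r addrA addrK.
Qed.


(** Passage from the GKLO identity [X A S = rr Q] to the twisted one: [X'] is [X] times [L / L'],
    the factors [g], [g'], [G] absorb this quotient, and [L'] clears the denominator. *)
Lemma balance_mul (L L' X X' A S rr Q g g' G : ser P) :
  L' ** X' = L ** X -> X ** A ** S = rr ** Q -> L ** (g ** g') = L' ** G ->
  L' ** (X' ** (A ** g) ** (S ** g')) = L' ** (rr ** (Q ** G)).
Proof.
move=> e1 e2 e3.
have -> : X' ** (A ** g) ** (S ** g') = X' ** (A ** S ** (g ** g')).
  by rewrite -ser_mulA Monoid.mulmACA.
rewrite ser_mulA e1 (ser_mulC L) Monoid.mulmACA /= e3 (ser_mulA X A S) e2.
by rewrite Monoid.mulmCA /= -(ser_mulA rr).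
Qed.

(** * Explicit solution of the twisted GKLO relation *)

Section Explicit.
Variables (n : nat) (c : 'I_n -> 'I_n -> int) (d : 'I_n -> nat).
Variables (mu : 'I_n -> int) (r : rgrp R n) (m : 'I_n -> nat) (i0 : 'I_n).
Hypothesis c_diag : forall i, c i i = 2.
Hypothesis c_off : forall i j, i != j -> c i j <= 0.
Hypothesis c_sym : forall i j, (d i)%:Z * c i j = (d j)%:Z * c j i.
Hypothesis Htrunc : forall j, rgrp_coweight r j - mu j = \sum_(i < n) (m i)%:Z * c i j.

Definition gklo_fac (j : 'I_n) : ser P :=
  if j == i0 then zfrac (d i0)%:R else ser_one P.

Definition gklo_twisted (a : 'I_n -> nat -> C) (j : 'I_n) : nat -> P :=
  (((m j)%:Z, fun k => (a j k)%:P) ** gklo_fac j).2.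

Lemma gklo_twistedE a j : ((m j)%:Z, gklo_twisted a j)
  = ((m j)%:Z, fun k => (a j k)%:P) ** gklo_fac j :> ser P.
Proof. by apply: serP => //; rewrite /= /gklo_fac; case: ifP; rewrite addr0. Qed.

(** Modifying [A_{i0}] compensates the twist of [xi_k]. For [k = i0] the two left factors collapse
    to [(u - z + d) / (u - z - d)], for a neighbour of [i0] the product on the right telescopes, and
    otherwise all factors are 1. *)
Lemma gklo_fac_balance k :
  zlin (dd R c d k i0) ** (gklo_fac k ** ser_shift (gklo_fac k) (d k)%:R)
  = zlin (- dd R c d k i0) **
    ser_prod [seq ser_shift (gklo_fac p.1) (gklo_arg R c d k p) | p <- gklo_pairs c k].
Proof.
rewrite ser_prodE big_map big_allpairs_dep /= big_filter big_enum_cond /=.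
have one_shift (j : 'I_n) : j != i0 ->
    \big[@ser_mul R P/@ser_one R P]_(t <- iota 1 `|c j k|)
      ser_shift (gklo_fac j) (gklo_arg R c d k (j, t)) = ser_one P.
  by move=> ji; rewrite big1 // => t _; rewrite /gklo_fac (negbTE ji) ser_shift_one.
case: (eqVneq k i0) => [ki|ki].
  rewrite big1 => [|j hj]; last by apply: one_shift; apply: contraTneq hj => ->; rewrite ki c_diag.
  rewrite Monoid.mulm1 /gklo_fac ki eqxx.
  have -> : dd R c d i0 i0 = (d i0)%:R.
    by rewrite /dd c_diag intrM mulfK // pnatr_eq0.
  rewrite [X in _ ** X]ser_mulC ser_mulA zlin_frac_shift subrr.
  exact: zlin_frac.
rewrite {1 2}/gklo_fac (negbTE ki) ser_shift_one !Monoid.mulm1.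
have ddE : dd R c d k i0 = (c i0 k)%:~R * (d i0)%:R / 2%:R.
  by rewrite /dd c_sym intrM; congr (_ / _); rewrite mulrC.
have c0 : c i0 k <= 0 by apply: c_off; rewrite eq_sym.
case: (ltrP (c i0 k) 0) => cn; last first.
  have c0' : c i0 k = 0 by apply/eqP; rewrite eq_le; apply/andP.
  rewrite ddE c0' !mul0r oppr0 big1 ?Monoid.mulm1 // => j hj.
  by apply: one_shift; apply: contraTneq hj => ->; rewrite c0'.
rewrite (bigD1 i0) //= [X in _ = _ ** (_ ** X)]big1; last first.
  by move=> j /andP[_]; exact: one_shift.
have cE : c i0 k = - (`|c i0 k|%N)%:Z by lia.
move: cE ddE; set N := `|c i0 k|%N => cE ddE.
(* For [b = d_{k i0} = - N d_{i0} / 2] one has [b + N d_{i0} = - b], the argument of [zlin] on the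
   right. *)
rewrite Monoid.mulm1 /gklo_fac eqxx -[LHS](zlin_frac_telescope _ (d i0)%:R N).
congr (zlin _ ** _).
by rewrite ddE cE rmorphN /= -pmulrn; field.
Qed.

Variable x a : 'I_n -> nat -> C.
Hypothesis x0 : forall i, x i 0%N = 1.
Hypothesis a0 : forall i, a i 0%N = 1.
Hypothesis xa : forall i k,
  gklo_defect c d mu r m (fun j l => (x j l)%:P : P) (fun j l => (a j l)%:P) i k = 0.

Lemma gklo_twisted_defect i k :
  gklo_defect c d mu r m (fun j => twist (dd R c d j i0) (x j)) (gklo_twisted a) i k = 0.
Proof.
have base := gklo_defect_eq c_diag c_off Htrunc (xa i).
suff e : gklo_lhs d mu m (fun j => twist (dd R c d j i0) (x j)) (gklo_twisted a) i
     = gklo_rhs c d r m (gklo_twisted a) i by rewrite /gklo_defect e subrr.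
(* The two sides are compared after clearing the denominator [u - z + d_{i i0}] of the twist. *)
apply: (@ser_mul_cancel _ _ (zlin (- dd R c d i i0))) => //.
rewrite /gklo_lhs /gklo_rhs.
rewrite gklo_twistedE ser_shiftM.
have -> : [seq ser_shift ((m p.1)%:Z, gklo_twisted a p.1) (gklo_arg R c d i p) | p <- gklo_pairs c i]
  = [seq ser_shift ((m p.1)%:Z, fun k => (a p.1 k)%:P) (gklo_arg R c d i p)
      ** ser_shift (gklo_fac p.1) (gklo_arg R c d i p) | p <- gklo_pairs c i].
  by apply: eq_map => p; rewrite gklo_twistedE ser_shiftM.
have -> : ser_prod [seq ser_shift ((m p.1)%:Z, fun k => (a p.1 k)%:P) (gklo_arg R c d i p)
      ** ser_shift (gklo_fac p.1) (gklo_arg R c d i p) | p <- gklo_pairs c i]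
  = ser_prod [seq ser_shift ((m p.1)%:Z, fun k => (a p.1 k)%:P) (gklo_arg R c d i p) | p <- gklo_pairs c i]
    ** ser_prod [seq ser_shift (gklo_fac p.1) (gklo_arg R c d i p) | p <- gklo_pairs c i].
  by rewrite !ser_prodE !big_map big_split.
exact: (balance_mul (zlin_twist _ _ _) base (gklo_fac_balance i)).
Qed.


End Explicit.
End Generic.

(** * Action on the highest weight module *)

Section LinearExtension.
Variables (R : realType) (W : lmodType R[i]) (u : nat -> W).
Local Notation C := R[i].

(* The linear extension of 'X^k |-> u k. *)
Definition polylin (f : {poly C}) : W := \sum_(k < size f) f`_k *: u k.

Implicit Types f g : {poly C}.

Lemma polylinE N f : (size f <= N)%N -> polylin f = \sum_(k < N) f`_k *: u k.
Proof.
move=> fN; rewrite /polylin (big_ord_widen N (fun k => f`_k *: u k)) //.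
rewrite [RHS](bigID (fun k : 'I_N => (k < size f)%N)) /= [X in _ + X]big1 ?addr0 //.
by move=> k; rewrite -leqNgt => fk; rewrite nth_default // scale0r.
Qed.

Lemma polylinD f g : polylin (f + g) = polylin f + polylin g.
Proof.
pose N := maxn (size f) (size g).
rewrite (@polylinE N) ?size_polyD // (@polylinE N f) ?leq_maxl //.
rewrite (@polylinE N g) ?leq_maxr // -big_split; apply: eq_bigr => k _ /=.
by rewrite coefD scalerDl.
Qed.

Lemma polylinZ a f : polylin (a *: f) = a *: polylin f.
Proof.
rewrite (@polylinE (size f)) ?size_scale_leq // scaler_sumr.
by apply: eq_bigr => k _; rewrite coefZ scalerA.
Qed.

Lemma polylin0 : polylin 0 = 0.
Proof. by rewrite /polylin size_poly0 big_ord0. Qed.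

Lemma polylinN f : polylin (- f) = - polylin f.
Proof. by rewrite -[- f]scaleN1r polylinZ scaleN1r. Qed.

Lemma polylin_sum (I : Type) (s : seq I) (P : pred I) (F : I -> {poly C}) :
  polylin (\sum_(i <- s | P i) F i) = \sum_(i <- s | P i) polylin (F i).
Proof. by apply: (big_morph polylin) => //; [exact: polylinD|exact: polylin0]. Qed.

Lemma polylinXn k : polylin 'X^k = u k.
Proof.
rewrite /polylin size_polyXn big_ord_recr /= coefXn eqxx scale1r big1 ?add0r // => l _.
by rewrite coefXn ltn_eqF ?ltn_ord // scale0r.
Qed.

Lemma polylin_mulX f : polylin ('X * f) = \sum_(k < size f) f`_k *: u k.+1.
Proof.
rewrite (@polylinE (size f).+1) ?big_ord_recl.
  by rewrite coefXM scale0r add0r; apply: eq_bigr => k _; rewrite coefXM.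
by rewrite mulrC; case: (eqVneq f 0) => [->|f0]; rewrite ?mul0r ?size_poly0 // size_mulX.
Qed.

End LinearExtension.

Section HighestWeight.
Variables (R : realType) (n : nat) (c : 'I_n -> 'I_n -> int) (d : 'I_n -> nat).
Local Notation C := R[i].
Local Notation P := {poly C}.
Variables (mu : 'I_n -> int) (r : rgrp R n) (m : 'I_n -> nat) (e : rgrp R n).
Hypothesis c_diag : forall i, c i i = 2.
Hypothesis c_off : forall i j, i != j -> c i j <= 0.
Hypothesis c_sym : forall i j, (d i)%:Z * c i j = (d j)%:Z * c j i.
Hypothesis d_gt0 : forall i, (0 < d i)%N.
Hypothesis Htrunc : forall j, rgrp_coweight r j - mu j = \sum_(i < n) (m i)%:Z * c i j.
Hypothesis e_mu : forall i, rgrp_coweight e i = mu i.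
Variable N : 'M[C]_n.
Hypothesis NC : forall i j, \sum_k N i k * (c k j)%:~R = (i == j)%:R.
Hypothesis CN : forall i j, \sum_k (c i k)%:~R * N k j = (i == j)%:R.

Let chi (i : 'I_n) : nat -> C^o := (rgrp_ser C^o e i).2.

Lemma rgrp_serE i : rgrp_ser C^o e i = (mu i, chi i).
Proof. by rewrite /chi -e_mu -(@rgrp_ser_deg _ C^o); case: (rgrp_ser _ _ _). Qed.

Lemma chi0 i : chi i 0%N = 1.
Proof. exact: rgrp_ser_lead. Qed.

Let a := gklo_sol (T := C^o) c d mu r m N chi.

Lemma eigen_lead i : a i 0%N = 1. Proof. exact: gklo_sol0. Qed.

Lemma eigen_defect i k : gklo_defect (T := C^o) c d mu r m chi a i k = 0.
Proof. exact: (gklo_sol_defect (T := C^o) d mu r m c_diag c_off NC i k chi0). Qed.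

(** The explicit series solves the twisted relation, so uniqueness identifies it with the recursion,
    whose action on vectors is accessible by naturality. *)
Lemma gklo_sol_twisted i0 j k :
  gklo_sol c d mu r m N (fun j => twist (dd R c d j i0) (chi j)) j k
  = gklo_twisted d m i0 a j k.
Proof.
apply/esym; apply: (gklo_unique c_diag c_off NC CN).
- by move=> i /=; rewrite chi0.
- move=> i; rewrite /gklo_twisted ser_mul_lead //= ?eigen_lead //.
  by rewrite /gklo_fac; case: ifP.
apply: gklo_twisted_defect => // i l.
transitivity ((gklo_defect (T := C^o) c d mu r m chi a i l)%:P); last by rewrite eigen_defect.
apply: (@gklo_defect_rel R n c d mu r m C^o P (fun p q => q = p%:P)) => //.
- by move=> p q p' q' -> ->; rewrite polyCD.
- by move=> p q p' q' -> ->; rewrite polyCM.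
- by move=> k' p p' ->; rewrite -mul_polyC polyCM.
Qed.

Variables (A : algType C) (V : lmodType A).
Variables (x : bool -> 'I_n -> nat -> A) (xi : 'I_n -> int -> A) (v : V).
Hypothesis rels : yangian_rels c d mu x xi.
Hypothesis v_neq0 : v != 0.
Hypothesis x_v : forall i k, x true i k *: v = 0.
Hypothesis xi_v : forall i p, xi i p *: v = scoef (rgrp_ser A e i) (- p - 1) *: v.
Hypothesis trunc_V : forall Aco : 'I_n -> nat -> A, gklo_series c d mu r m xi Aco ->
  forall i (k : nat), (m i < k)%N -> forall w : V, Aco i k *: w = 0.

Let Xi i k := xi i (k%:Z - mu i - 1).
Let Aco := gklo_sol c d mu r m N Xi.

Lemma Xi0 i : Xi i 0%N = 1.
Proof. by have [_ [_ [_ [_ [_ [h _]]]]]] := rels; rewrite /Xi sub0r h. Qed.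

Lemma Aco_gklo : gklo_series c d mu r m xi Aco.
Proof.
split=> [i k|i|i /=].
(* Membership in the subalgebra generated by the [xi] is treated as a relation that ignores its
   scalar side. *)
- apply: (@gklo_sol_rel R n c d mu r m A C^o (fun p _ => in_xi_alg xi p) _ _ _ _ N Xi chi) => //.
  + exact: xa_one.
  + by move=> *; exact: xa_add.
  + by move=> *; exact: xa_mul.
  + by move=> *; exact: xa_scale.
  + by move=> *; exact: xa_gen.
- exact: gklo_sol0.
- have := gklo_defect_eq c_diag c_off Htrunc (fun k => gklo_sol_defect d mu r m c_diag c_off NC i k Xi0).
  rewrite /gklo_lhs /gklo_rhs -gklo_flatten => h p.
  by rewrite -[in RHS]h.
Qed.

Lemma scalar_inj (z : C) : z%:A *: v = 0 -> z = 0.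
Proof.
move=> h; apply/eqP; apply: contraNT v_neq0 => z0.
have -> : v = (z^-1)%:A *: (z%:A *: v).
  by rewrite scalerA mulr_algl scalerA mulVf // !scale1r.
by rewrite h scaler0.
Qed.

Lemma scoef_algebra i p : scoef (rgrp_ser A e i) p = (scoef (rgrp_ser C^o e i) p : C)%:A.
Proof.
have [dg h] : ser_rel (fun (q : C^o) (q' : A) => q' = (q : C)%:A)
    (rgrp_ser C^o e i) (rgrp_ser A e i).
  apply: ser_rel_rgrp.
  - by rewrite scale1r.
  - by move=> q p' q' p'' -> ->; rewrite scalerDl.
  - by move=> q p' q' p'' -> ->; rewrite -scalerAl mul1r scalerA.
  - by move=> k q q' ->; rewrite scalerA.
rewrite /scoef -dg h; case: ifP => // _.
by rewrite scale0r.
Qed.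

Lemma Xi_v i k : Xi i k *: v = (chi i k)%:A *: v.
Proof.
rewrite /Xi xi_v scoef_algebra rgrp_serE /scoef /=.
have -> : mu i - (- (k%:Z - mu i - 1) - 1) = k%:Z by lia.
by [].
Qed.

Lemma Aco_v i k : Aco i k *: v = (a i k)%:A *: v.
Proof.
apply: (@gklo_sol_rel R n c d mu r m A C^o (fun p q => p *: v = (q : C)%:A *: v)).
- by rewrite !scale1r.
- by move=> p q p' q' h h'; rewrite scalerDl h h' -scalerDl -scalerDl.
- move=> p q p' q' h h'; rewrite -scalerA h' scalerA mulr_algr -[q' *: p]mulr_algl.
  by rewrite -scalerA h scalerA mulr_algl scalerA mulrC.
- move=> k' p p' h.
  by rewrite -[k' *: p]mulr_algl -scalerA h scalerA mulr_algl scalerA.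
- exact: Xi_v.
Qed.

Lemma eigen_trunc i k : (m i < k)%N -> a i k = 0.
Proof. by move=> mk; apply: scalar_inj; rewrite -Aco_v (trunc_V Aco_gklo). Qed.

(** * The vectors [x^-_{i0,k} v] *)

Section Node.
Variable i0 : 'I_n.
Let X (f : P) : A := polylin (x false i0) f.

Lemma xi_X_comm j p f :
  comm (xi j (p + 1)) (X f) - comm (xi j p) (X ('X * f))
  = - dd R c d j i0 *: (xi j p * X f + X f * xi j p).
Proof.
have [_ [_ [h _]]] := rels.
rewrite {2}/X polylin_mulX /X /polylin /comm !mulr_sumr !mulr_suml.
rewrite -!sumrB -big_split scaler_sumr; apply: eq_bigr => k _ /=.
have := h false j i0 p k; rewrite /comm /= mulN1r => E.
rewrite -!scalerAr -!scalerAl -!scalerBr E -scalerDr scalerA mulrC.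
by rewrite scalerA.
Qed.

(** An intertwining condition, because the vectors [x^-_{i0,k} v] may be linearly dependent and then
    do not determine [p]. *)
Definition acts_as (q : A) (p : P) := forall f, q *: (X f *: v) = X (p * f) *: v.

Lemma X_scale (k : C) f (w : V) : X (k *: f) *: w = k%:A *: (X f *: w).
Proof. by rewrite /X polylinZ scalerA mulr_algl. Qed.

Lemma X_Xi f j k : X f *: (Xi j k *: v) = X ((chi j k)%:P * f) *: v.
Proof. by rewrite Xi_v scalerA mulr_algr mul_polyC /X polylinZ. Qed.

(** Applied to [v], [xi_X_comm] expresses [xi_{j,p+1}] through [xi_{j,p}], which is the recursion of
    [twist]. *)
Lemma Xi_acts j k : acts_as (Xi j k) (twist (dd R c d j i0) (chi j) k).
Proof.
elim: k => [|k IH] f; first by rewrite Xi0 scale1r /= chi0 polyC1 mul1r.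
have := congr1 (fun q => q *: v) (xi_X_comm j (k%:Z - mu j - 1) f).
have e1 : k%:Z - mu j - 1 + 1 = k.+1%:Z - mu j - 1 by lia.
rewrite /comm e1 -/(Xi j k.+1) -/(Xi j k) !scalerBl -!scalerA !X_Xi !IH.
rewrite -[- dd R c d j i0 *: _]mulr_algl -scalerA scalerDl -!scalerA X_Xi IH.
rewrite /X -scalerDl -polylinD [(- dd R c d j i0)%:A *: _]scalerA mulr_algl -polylinZ.
move/eqP; rewrite subr_eq => /eqP; move/eqP; rewrite subr_eq => /eqP ->.
rewrite -scalerBl -!scalerDl -polylinN -!polylinD; congr (polylin _ _ *: v).
by rewrite -mul_polyC polyCN /=; ring.
Qed.

Lemma Aco_acts k : acts_as (Aco i0 k) (gklo_twisted d m i0 a i0 k).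
Proof.
rewrite -gklo_sol_twisted.
apply: (@gklo_sol_rel R n c d mu r m A P acts_as).
- by move=> f; rewrite scale1r mul1r.
- by move=> p q p' q' h h' f; rewrite scalerDl h h' mulrDl /X polylinD scalerDl.
- by move=> p q p' q' h h' f; rewrite -scalerA h' h mulrA.
- by move=> k' p p' h f; rewrite -mulr_algl -scalerA h -X_scale scalerAl.
- exact: Xi_acts.
Qed.

Let eig (q : nat) : C^o := scoef (rgrp_ser C^o e i0) (- q%:Z - 1).

(** As [x^+] kills [v], only the commutator [xi_{i0,k}] of [x^+_{i0,0}] and [x^-_{i0,k}] survives,
    and it acts on [v] by [eig k]. *)
Lemma raise_X f : x true i0 0%N *: (X f *: v) = (polylin eig f : C)%:A *: v.
Proof.
have [_ [h _]] := rels.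
rewrite /X /polylin !scaler_suml scaler_sumr; apply: eq_bigr => k _.
have := congr1 (fun q => q *: v) (h i0 i0 0%N k).
rewrite eqxx add0r /comm scalerBl -!scalerA x_v scaler0 subr0 xi_v scoef_algebra => E.
rewrite -[_ *: x false _ _]mulr_algl -scalerA scalerA mulr_algr -[_ *: x true _ _]mulr_algl -scalerA E.
by rewrite [LHS]scalerA mulr_algl.
Qed.

Lemma trunc_conv k : (m i0 < k)%N -> \sum_(l < k) a i0 l * eig (k - l.+1) = 0.
Proof.
move=> mk.
have := raise_X (gklo_twisted d m i0 a i0 k).
(* The polynomial 1 stands for [x^-_{i0,0} v], which truncation forces the coefficient of order [k]
   of [A_{i0}] to kill. *)
have := Aco_acts k 1; rewrite (trunc_V Aco_gklo) // mulr1 => <-.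
rewrite scaler0 => /esym/scalar_inj.
(* The term [l = k] is [a_k], zero by truncation; the terms [l < k] are
   [d_{i0} a_l z^(k - l - 1)]. *)
rewrite /gklo_twisted /gklo_fac eqxx /= big_ord_recr /= eigen_trunc // mul0r addr0.
rewrite polylin_sum => h; have d0 : (d i0)%:R != 0 :> C by rewrite pnatr_eq0 -lt0n.
apply: (mulfI d0); rewrite mulr0 -[RHS]h mulr_sumr; apply: eq_bigr => l _.
have -> : (k - l = (k - l.+1).+1)%N by have := ltn_ord l; lia.
rewrite mul_polyC scalerA polylinZ polylinXn.
by rewrite -[RHS]/(_ * _) mulrCA mulrA.
Qed.

Lemma trunc_polynomial p : p < 0 ->
  scoef (rgrp_ser C^o e i0 ** ((m i0)%:Z, a i0)) p = 0.
Proof.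
move=> p0; rewrite rgrp_serE ser_mulC /scoef /=; case: ifP => // tp.
set t := `|_|%N; have te : t%:Z = (m i0)%:Z + mu i0 - p by rewrite /t; lia.
(* For this [k] the convolution of [trunc_conv] is the coefficient of [u^p], and [p < 0] gives
   [k > m]. *)
pose k := `|(m i0)%:Z - p|%N; have ke : k%:Z = (m i0)%:Z - p by rewrite /k; lia.
have mk : (m i0 < k)%N by lia.
rewrite -[RHS](trunc_conv mk).
(* Both sums are extended to a common range: [a_l] vanishes for [l >= k], and for [l > t] the term
   [eig] lies above the leading degree of [e]. *)
rewrite (big_ord_widen (k + t.+1) (fun l => a i0 l * chi i0 (t - l)%N)) ?leq_addl //.
rewrite [RHS](big_ord_widen (k + t.+1) (fun l => a i0 l * eig (k - l.+1))) ?leq_addr //.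
rewrite big_mkcond [RHS]big_mkcond /=; apply: eq_bigr => l _.
case: (ltnP l k) => lk; last by rewrite eigen_trunc ?mul0r ?if_same //; lia.
rewrite /eig rgrp_serE /scoef /=.
have -> : mu i0 - (- (k - l.+1)%N%:Z - 1) = t%:Z - l%:Z by lia.
rewrite subr_ge0 lez_nat ltnS; case: ifP => lt; last by rewrite mulr0.
by congr (_ * chi i0 _); lia.
Qed.

End Node.
End HighestWeight.

(** * Series of rational functions and their divisors *)

Section RootSeries.
Variable R : realType.
Local Notation C := R[i].
Local Notation S := (ser C^o).
Implicit Types s t : seq C.

Definition root_ser s : S := ser_prod [seq ser_linpow C^o a 1 | a <- s].

Lemma root_ser_lead s : (root_ser s).2 0%N = 1.
Proof.
rewrite /root_ser ser_prodE big_map ser_prod_lead // => a _.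
by rewrite /= gbin0 mul1r scale1r.
Qed.

Lemma root_ser_deg s : (root_ser s).1 = (size s)%:Z.
Proof. by elim: s => //= a s IH; rewrite IH. Qed.

Lemma linpow1_coef (a : C) k :
  (ser_linpow C^o a 1).2 k = if k is k'.+1 then (k' == 0%N)%:R * - a else 1.
Proof.
rewrite /=; case: k => [|[|k]]; first by rewrite gbin0 mul1r scale1r.
  by rewrite (gbin_nat R 1) bin1 expr1 eqxx !mul1r; exact: mulr1.
by rewrite gbin1SS !mul0r scale0r.
Qed.

Lemma root_ser_consS a s k :
  (root_ser (a :: s)).2 k.+1 = (root_ser s).2 k.+1 - a * (root_ser s).2 k.
Proof.
rewrite [LHS]/= big_ord_recl big_ord_recl big1 => [|i _].
  rewrite addr0 gbin0 !mul1r scale1r mul1r subn0 subSS subn0.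
  by rewrite -[X in X * _]/((ser_linpow C^o a 1).2 1%N) linpow1_coef mul1r mulNr.
by rewrite -[X in X * _]/((ser_linpow C^o a 1).2 i.+2) linpow1_coef mul0r mul0r.
Qed.

Lemma root_ser_coef s k :
  (root_ser s).2 k = if (k <= size s)%N
    then (\prod_(a <- s) ('X - a%:P))`_(size s - k) else 0.
Proof.
elim: s k => [|a s IH] k.
  by rewrite big_nil leqn0 /= coef1 sub0n eqxx; case: eqP.
case: k => [|k].
  rewrite root_ser_lead subn0 -[size (a :: s)]/((size (a :: s)).+1.-1).
  rewrite -(size_prod_XsubC _ id) -/(lead_coef _) (monicP _) //.
  exact: monic_prod_XsubC.
rewrite root_ser_consS !IH big_cons ltnS /= subSS mulrBl coefB coefXM coefCM.
case: (ltngtP k (size s)) => ks.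
- rewrite ifF; last by lia.
  by rewrite subnS.
- by rewrite mulr0 subr0.
- by rewrite ks subnn.
Qed.

Lemma root_ser_inj s t : root_ser s = root_ser t -> perm_eq s t.
Proof.
move=> e; have ss : size s = size t.
  by have := congr1 fst e; rewrite !root_ser_deg => -[].
apply: prod_XsubC_eq; apply/polyP => i.
case: (leqP i (size s)) => si; last first.
  by rewrite !nth_default // size_prod_XsubC // -ss.
have := congr1 (fun F : S => F.2 (size s - i)%N) e.
by rewrite !root_ser_coef -ss leq_subr subKn.
Qed.

(** Without negative powers [F] is a monic polynomial in [u], which splits because [R[i]] is
    algebraically closed. *)
Lemma root_ser_exists (F : S) : F.2 0%N = 1 -> (forall p, p < 0 -> scoef F p = 0) ->
  exists s, F = root_ser s.
Proof.
case: F => D f /= f0 h.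
have : 0 <= D.
  rewrite leNgt; apply/negP => /h; rewrite /scoef /= subrr lexx /= f0.
  by apply/eqP; exact: oner_neq0.
case: D h => // N h _.
(* Series are indexed downwards from the leading term and polynomials upwards from the constant
   term, hence the reversal. *)
pose p : {poly C} := \poly_(i < N.+1) f (N - i)%N.
have szp : size p = N.+1 by rewrite size_poly_eq // subnn f0 oner_neq0.
have [s ps] := closed_field_poly_normal p.
have lp : lead_coef p = 1 by rewrite /lead_coef szp coef_poly ltnSn subnn f0.
rewrite lp scale1r in ps.
have sN : size s = N by have := szp; rewrite ps size_prod_XsubC => -[].
exists s; apply: serP => [|k]; first by rewrite root_ser_deg sN.
rewrite root_ser_coef sN -ps coef_poly ltnS leq_subr; case: leqP => kN /=.
  by rewrite subKn.
have hk : N%:Z - k%:Z < 0 by lia.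
have := h _ hk; rewrite /scoef /=.
by have -> : N%:Z - (N%:Z - k%:Z) = k%:Z by lia.
Qed.

Lemma root_ser_cat s t : root_ser (s ++ t) = root_ser s ** root_ser t.
Proof. by rewrite /root_ser !ser_prodE !big_map big_cat. Qed.

Lemma root_ser_flatten (ss : seq (seq C)) :
  root_ser (flatten ss) = ser_prod [seq root_ser s | s <- ss].
Proof. by elim: ss => //= s ss IH; rewrite root_ser_cat IH. Qed.

Lemma linpow1_shift (a b : C) :
  ser_shift (ser_linpow C^o b 1) a = ser_linpow C^o (b + a) 1.
Proof.
apply: serP => // t; rewrite linpow1_coef.
case: t => [|t]; first by rewrite ser_shift_lead linpow1_coef.
rewrite /ser_shift /snd big_ord_recl big_ord_recl big1 => [|i _]; last first.
  by rewrite -/(ser_linpow C^o b 1) -[X in _ *: X]/((ser_linpow C^o b 1).2 i.+2) linpow1_coef mul0r scaler0.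
rewrite -[X in _ *: X + _]/((ser_linpow C^o b 1).2 0%N).
rewrite -[X in _ + (_ *: X + _)]/((ser_linpow C^o b 1).2 1%N) !linpow1_coef.
rewrite /= subSS !subn0 gbin0n.
case: t => [|t]; last by rewrite gbin1SS !mul0r !scale0r !addr0.
rewrite (gbin_nat R 1) bin1 eqxx expr1 expr0 !mul1r scale1r.
by rewrite addr0 -[_%:A]/(_ * 1) mulr1 opprD addrC.
Qed.

Lemma root_ser_shift s a : ser_shift (root_ser s) a = root_ser [seq b + a | b <- s].
Proof.
rewrite /root_ser !ser_prodE !big_map ser_shift_prod.
by apply: eq_bigr => b _; rewrite linpow1_shift.
Qed.

Lemma root_ser_nseq k a : root_ser (nseq k a) = ser_linpow C^o a k%:Z.
Proof.
elim: k => [|k IH]; first by rewrite ser_linpow0.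
by rewrite -[LHS]/(_ ** root_ser (nseq k a)) IH ser_linpowD.
Qed.

Definition posn (z : int) : nat := if z is Posz k then k else 0%N.
Definition negn (z : int) : nat := posn (- z).

Lemma posn_negn (z : int) : z + (negn z)%:Z = (posn z)%:Z.
Proof. by rewrite /negn /posn; case: z => k; case E : (- _) => [l|l] /=; lia. Qed.

Definition zeros (f : {fsfun C -> int with 0}) : seq C :=
  flatten [seq nseq (posn (f a)) a | a <- finsupp f].
Definition poles (f : {fsfun C -> int with 0}) : seq C :=
  flatten [seq nseq (negn (f a)) a | a <- finsupp f].

Lemma rgrp_ser_zeros_poles n (e : rgrp R n) i :
  rgrp_ser C^o e i ** root_ser (poles (e i)) = root_ser (zeros (e i)).
Proof.
rewrite /rgrp_ser /zeros /poles !root_ser_flatten !ser_prodE !big_map -big_split.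
by apply: eq_bigr => a _; rewrite !root_ser_nseq /= ser_linpowD posn_negn.
Qed.

Lemma count_flatten_nseq (g : int -> nat) (f : {fsfun C -> int with 0}) b :
  g 0 = 0%N ->
  count_mem b (flatten [seq nseq (g (f a)) a | a <- finsupp f]) = g (f b).
Proof.
move=> g0; rewrite count_flatten -map_comp sumnE big_map.
have E a : (count_mem b \o (fun a => nseq (g (f a)) a)) a = if a == b then g (f b) else 0%N.
  rewrite /= count_nseq /=; case: eqP => [->|_]; first by rewrite mul1n.
  by rewrite mul0n.
under eq_bigr => a _ do rewrite E.
case: (boolP (b \in finsupp f)) => hb.
  rewrite (bigD1_seq b) ?fset_uniq //= eqxx big1 ?addn0 // => a /negbTE ab.
  by rewrite ab.
rewrite big_seq_cond big1 ?fsfun_dflt // => a /andP[ha _].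
by case: eqP => // ab; rewrite ab (negbTE hb) in ha.
Qed.

(** Moving the poles across the equality leaves products of linear factors, and counting
    multiplicities recovers the exponents. *)
Lemma rgrp_ser_inj n (e e' : rgrp R n) i :
  rgrp_ser C^o e i = rgrp_ser C^o e' i -> e i = e' i.
Proof.
move=> h; apply/fsfunP => b.
have : root_ser (zeros (e i) ++ poles (e' i)) = root_ser (zeros (e' i) ++ poles (e i)).
  rewrite !root_ser_cat -!rgrp_ser_zeros_poles h -!ser_mulA; congr (_ ** _).
  exact: ser_mulC.
move/root_ser_inj/permP => /(_ (pred1 b)).
rewrite !count_cat !(count_flatten_nseq (g := posn)) //
  !(count_flatten_nseq (g := negn)) //.
have := posn_negn (e i b); have := posn_negn (e' i b); lia.
Qed.

End RootSeries.

(** * Finiteness *)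

(** Each parameter has at most one solution; excluded middle decides whether there is one to add to
    the list. *)
Lemma finite_of_finite_parameters (I : finType) (X : eqType) (Q : I -> X -> Prop) :
  (forall i x y, Q i x -> Q i y -> x = y) ->
  exists s : seq X, forall i x, Q i x -> x \in s.
Proof.
move=> uQ; suff [s hs] : exists s : seq X, forall i, i \in enum I -> forall x, Q i x -> x \in s.
  by exists s => i; apply: hs; rewrite mem_enum.
elim: (enum I) => [|i l [s IH]]; first by exists [::].
have [[x Qx]|nQ] := boolp.EM (exists x, Q i x).
  exists (x :: s) => j; rewrite inE => /orP[/eqP-> y Qy|jl y Qy].
    by rewrite inE (uQ _ _ _ Qy Qx) eqxx.
  by rewrite inE (IH j) ?orbT.
exists s => j; rewrite inE => /orP[/eqP-> y Qy|jl y Qy]; last exact: (IH j).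
by case: nQ; exists y.
Qed.

Lemma finite_of_finite_roots (n : nat) (T : eqType) (X : eqType) (B : seq T) (m : 'I_n -> nat)
    (G : X -> ('I_n -> seq T) -> Prop) :
  (forall x s, G x s -> forall i, size (s i) = m i /\ {subset s i <= B}) ->
  (forall x y s, G x s -> G y s -> x = y) ->
  exists l : seq X, forall x s, G x s -> x \in l.
Proof.
(* Decoding by [nth] needs a default element, so an empty [B], which makes every [s i] empty, is
   handled apart. *)
case: B => [|b0 B'] hB uG.
  pose s0 (i : 'I_n) : seq T := [::].
  have [l hl] := @finite_of_finite_parameters unit X (fun _ x => G x s0) (fun _ x y => uG x y s0).
  exists l => x s Gs; apply: (hl tt); suff -> : s0 = s by [].
  apply: boolp.funext => i; have [_ h] := hB x s Gs i.
  by case: (s i) h => // y t /(_ y); rewrite inE eqxx => /(_ isT).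
set B := b0 :: B' in hB *.
(* [M] bounds all lengths [m i] at once; a family of roots is then encoded by the positions of its
   members in [B]. *)
pose M := \sum_i m i.
pose fam (f : {ffun 'I_n -> {ffun 'I_M.+1 -> 'I_(size B).+1}}) (i : 'I_n) : seq T :=
  mkseq (fun k => nth b0 B (f i (inord k))) (m i).
have [l hl] := @finite_of_finite_parameters _ X (fun f x => G x (fam f)) (fun f x y => uG x y (fam f)).
exists l => x s Gs.
pose f : {ffun 'I_n -> {ffun 'I_M.+1 -> 'I_(size B).+1}} :=
  [ffun i => [ffun k : 'I_M.+1 => inord (index (nth b0 (s i) k) B)]].
apply: (hl f); suff -> : fam f = s by [].
apply: boolp.funext => i; have [si sB] := hB x s Gs i.
apply: (@eq_from_nth _ b0); first by rewrite size_mkseq si.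
move=> k; rewrite size_mkseq => km.
have kM : (k < M.+1)%N.
  by rewrite ltnS (leq_trans (ltnW km)) // /M (bigD1 i) //= leq_addr.
have hk : nth b0 (s i) k \in B by apply: sB; rewrite mem_nth // si.
rewrite nth_mkseq // !ffunE.
have -> : (inord k : 'I_M.+1) = k :> nat by rewrite inordK.
by rewrite inordK ?nth_index // ltnS index_size.
Qed.

Lemma count_lt (T : eqType) (p q : pred T) (l : seq T) x :
  (forall y, p y -> q y) -> x \in l -> q x -> ~~ p x -> (count p l < count q l)%N.
Proof.
move=> pq; elim: l => // y l IH; rewrite inE => /orP[/eqP<-|xl] qx px /=.
  by rewrite qx (negbTE px) add0n ltnS; exact: sub_count.
have := IH xl qx px; have := pq y; by case: (p y); case: (q y) => //= h; lia.
Qed.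

(** * Consequences of positive definiteness *)

Section CartanInverse.
Variables (R : realType) (n : nat) (c : 'I_n -> 'I_n -> int) (d : 'I_n -> nat).
Local Notation C := R[i].
Hypothesis posdef : forall x : 'I_n -> rat, (exists i, x i != 0) ->
  0 < \sum_(i < n) \sum_(j < n) x i * ((d i)%:Z * c i j)%:~R * x j.

(** A kernel vector has length zero for the symmetrized form, which is positive definite. *)
Lemma cartan_unit : (\matrix_(i, j) (c i j)%:~R : 'M[rat]_n) \in unitmx.
Proof.
rewrite -unitmx_tr -row_free_unit; apply: inj_row_free => v v0.
apply/eqP; apply: contraT => vn0.
have [i vi] : exists i, v 0 i != 0.
  by case/rV0Pn: vn0 => i; exists i.
have := posdef (ex_intro (fun i => v 0 i != 0) i vi).
rewrite big1 ?ltxx // => j _.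
transitivity (v 0 j * (d j)%:R * (v *m (\matrix_(i, j) (c i j)%:~R)^T) 0 j).
  rewrite mxE mulr_sumr; apply: eq_bigr => k _; rewrite !mxE intrM -pmulrn; ring.
by rewrite v0 mxE mulr0.
Qed.

Lemma cartan_inverse : exists N : 'M[C]_n,
  (forall i j, \sum_k N i k * (c k j)%:~R = (i == j)%:R) /\
  (forall i j, \sum_k (c i k)%:~R * N k j = (i == j)%:R).
Proof.
pose K : 'M[rat]_n := \matrix_(i, j) (c i j)%:~R.
have KE i j : map_mx (ratr : rat -> C) K i j = (c i j)%:~R by rewrite !mxE ratr_int.
have uK := cartan_unit; rewrite -/K in uK.
exists (map_mx (ratr : rat -> C) (invmx K)); split=> i j.
  transitivity ((map_mx (ratr : rat -> C) (invmx K) *m map_mx (ratr : rat -> C) K) i j).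
    by rewrite mxE; apply: eq_bigr => k _; rewrite KE.
  by rewrite -map_mxM mulVmx // map_mx1 mxE.
transitivity ((map_mx (ratr : rat -> C) K *m map_mx (ratr : rat -> C) (invmx K)) i j).
  by rewrite mxE; apply: eq_bigr => k _; rewrite KE.
by rewrite -map_mxM mulmxV // map_mx1 mxE.
Qed.

Hypothesis c_diag : forall i, c i i = 2.
Hypothesis c_sym : forall i j, (d i)%:Z * c i j = (d j)%:Z * c j i.

(* The right-hand side is (alpha_i + alpha_j, alpha_i + alpha_j) / 2. *)
Lemma root_sum_pos i j : i != j -> 0 < (d i)%:Z + (d j)%:Z + (d i)%:Z * c i j.
Proof.
move=> ij; pose x (k : 'I_n) : rat := ((k == i) || (k == j))%:R.
have : exists k, x k != 0 by exists i; rewrite /x eqxx.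
move/posdef.
have sumx (F : 'I_n -> rat) : \sum_k x k * F k = F i + F j.
  rewrite (bigD1 i) //= (bigD1 j) /=; last by rewrite eq_sym.
  rewrite /x !eqxx orbT !mul1r big1 ?addr0 // => k /andP[/negbTE-> /negbTE->].
  by rewrite mul0r.
have -> : \sum_(k < n) \sum_(l < n) x k * ((d k)%:Z * c k l)%:~R * x l
  = ((2 * ((d i)%:Z + (d j)%:Z + (d i)%:Z * c i j))%:~R : rat).
  transitivity (\sum_k x k * \sum_l x l * ((d k)%:Z * c k l)%:~R).
    by apply: eq_bigr => k _; rewrite mulr_sumr; apply: eq_bigr => l _; ring.
  rewrite sumx !sumx !c_diag -(c_sym i j) -!intrD; congr (_%:~R).
  ring.
by rewrite ltr0z; lia.
Qed.

End CartanInverse.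

Section Finiteness.
Variables (R : realType) (n : nat) (c : 'I_n -> 'I_n -> int) (d : 'I_n -> nat).
Variables (mu : 'I_n -> int) (r : rgrp R n) (m : 'I_n -> nat).
Local Notation C := R[i].
Local Notation arg := (gklo_arg R c d).

(* [s j] lists the roots of the eigenvalue of [A_j(u)] on the highest weight
   vector; the last clause says that [e_i(u)] times this eigenvalue has no pole. *)
Definition truncated_roots (e : rgrp R n) (s : 'I_n -> seq C) : Prop :=
  [/\ forall j, size (s j) = m j,
      forall i, rgrp_ser C^o e i ** root_ser (s i) ** ser_shift (root_ser (s i)) (d i)%:R
        = rgrp_ser C^o r i **
          ser_prod [seq ser_shift (root_ser (s p.1)) (arg i p) | p <- gklo_pairs c i] &
      forall i, exists t, rgrp_ser C^o e i ** root_ser (s i) = root_ser t].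

Lemma truncated_roots_inj e e' s :
  truncated_roots e s -> truncated_roots e' s -> e = e'.
Proof.
move=> [_ h _] [_ h' _]; apply/ffunP => i; apply: rgrp_ser_inj.
apply: (@ser_mul_cancel _ _ (root_ser (s i) ** ser_shift (root_ser (s i)) (d i)%:R)).
  by rewrite ser_mul_lead // ?ser_shift_lead root_ser_lead.
by rewrite ser_mulC ser_mulA h [RHS]ser_mulC ser_mulA h'.
Qed.

(** Once [e_i p_i] is replaced by a polynomial and the poles of [r_i] are cleared, both sides are
    products of linear factors. Comparing their roots locates [b + d_i] on the right. *)
Lemma truncated_roots_step e s i b : truncated_roots e s -> b \in s i ->
  b + (d i)%:R \in zeros (r i) \/
  exists p b', [/\ p \in gklo_pairs c i, b' \in s p.1 & b + (d i)%:R = b' + arg i p].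
Proof.
move=> [_ h ht] bs; have [t et] := ht i.
have : root_ser t ** ser_shift (root_ser (s i)) (d i)%:R ** root_ser (poles (r i))
    = root_ser (zeros (r i)) **
      ser_prod [seq ser_shift (root_ser (s p.1)) (arg i p) | p <- gklo_pairs c i].
  rewrite -et h -rgrp_ser_zeros_poles -!ser_mulA; congr (_ ** _).
  exact: ser_mulC.
have -> : [seq ser_shift (root_ser (s p.1)) (arg i p) | p <- gklo_pairs c i]
  = [seq root_ser q | q <- [seq [seq a + arg i p | a <- s p.1] | p <- gklo_pairs c i]].
  by rewrite -map_comp; apply: eq_map => p /=; rewrite root_ser_shift.
rewrite root_ser_shift -root_ser_flatten -!root_ser_cat => /root_ser_inj/perm_mem.
have hb : b + (d i)%:R \in [seq a + (d i)%:R | a <- s i] by apply/mapP; exists b.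
move/(_ (b + (d i)%:R)); rewrite !mem_cat hb orbT /= => /esym/orP[hz|]; first by left.
case/flattenP => q /mapP[p pp ->] /mapP[b' b's E].
by right; exists p, b'.
Qed.

(** * Heights and chains of roots *)

Hypothesis c_diag : forall i, c i i = 2.
Hypothesis c_off : forall i j, i != j -> c i j <= 0.
Hypothesis c_sym : forall i j, (d i)%:Z * c i j = (d j)%:Z * c j i.
Hypothesis posdef : forall x : 'I_n -> rat, (exists i, x i != 0) ->
  0 < \sum_(i < n) \sum_(j < n) x i * ((d i)%:Z * c i j)%:~R * x j.

(** The midpoint of [b] and [b + d_i]. Heights are compared in the partial order of [R[i]], where
    [<] means that the difference is a positive real. *)
Definition height (q : 'I_n * C) : C := q.2 + (d q.1)%:R / 2%:R.

Lemma height_step i b p b' : p \in gklo_pairs c i -> b + (d i)%:R = b' + arg i p ->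
  height (i, b) < height (p.1, b').
Proof.
case: p => j t /allpairsPdep[j' [t' [+ + [-> ->]]]].
rewrite mem_filter => /andP[cji _]; rewrite mem_iota => tc E.
have ij : i != j' by apply: contraTneq cji => ->; rewrite c_diag.
have hs := root_sum_pos posdef c_diag c_sym ij.
have := c_sym i j' => cs.
(* [z] is twice the gain in height. Since [t' <= - c_ji], it is at least [d_i + d_j + d_i c_ij],
   positive by [root_sum_pos]. *)
pose z : int := (d i)%:Z + (d j')%:Z - (d i)%:Z * c i j' - 2 * t'%:Z * (d j')%:Z.
have z0 : 0 < z by rewrite /z; nia.
rewrite -subr_gt0.
have -> : height (j', b') - height (i, b) = z%:~R / 2%:R.
  have -> : b' = b + (d i)%:R - arg i (j', t') by rewrite E addrK.
  rewrite /height /gklo_arg /dd /z /= !rmorphB !rmorphD !intrM /=.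
  by field.
by rewrite divr_gt0 ?ltr0z ?ltr0n.
Qed.

(** Built backwards from the zeros of [r], hence independent of [e]; it contains every root joined
    to such a zero by a chain of at most [k] steps. *)
Fixpoint reachable (k : nat) : seq ('I_n * C) :=
  if k is k'.+1 then
    [seq (i, b - (d i)%:R) | i <- enum 'I_n, b <- zeros (r i)] ++
    [seq (u.1, u.2.2 + arg u.1 (u.2.1, t) - (d u.1)%:R)
       | u <- [seq (i, q) | i <- enum 'I_n, q <- reachable k'], t <- iota 1 `|c u.2.1 u.1|]
  else [::].

Lemma truncated_roots_reachable e s i b : truncated_roots e s -> b \in s i ->
  (i, b) \in reachable (\sum_j m j).+1.
Proof.
move=> h; have [sz _ _] := h.
pose L : seq ('I_n * C) := [seq (j, a) | j <- enum 'I_n, a <- s j].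
have memL j a : a \in s j -> (j, a) \in L.
  by move=> aj; apply/allpairsPdep; exists j, a; rewrite mem_enum.
have sizeL : size L = (\sum_j m j)%N.
  rewrite size_allpairs_dep sumnE big_map big_enum /=.
  by apply: eq_bigr => j _; rewrite sz.
(* Induction on the number of listed roots strictly higher than the given one: a step lowers it,
   because the root reached is no longer counted. *)
suff main k j a : (count (fun q => (height (j, a) < height q)%R) L < k)%N ->
    a \in s j -> (j, a) \in reachable k.
  by apply: main; rewrite ltnS -sizeL count_size.
elim: k j a => // k IH j a hk aj; rewrite /= mem_cat.
have [hz|[p [b' [pp b's E]]]] := truncated_roots_step h aj.
  apply/orP; left; apply/allpairsPdep; exists j, (a + (d j)%:R).
  by rewrite mem_enum hz addrK.
have hs := height_step pp E.
have b'r : (p.1, b') \in reachable k.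
  rewrite ltnS in hk; apply: IH => //; apply: leq_trans hk.
  apply: (count_lt (x := (p.1, b'))) => //; last by rewrite ltxx.
  - by move=> y; exact: lt_trans.
  - exact: memL.
apply/orP; right; case: p pp E b's b'r {hs} => j' t + E b's b'r.
case/allpairsPdep => j1 [t1 [+ t1i [ej et]]]; subst j1 t1 => _.
apply/allpairsPdep; exists (j, (j', b')), t; split=> //=.
  by apply/allpairsPdep; exists j, (j', b'); rewrite mem_enum.
by rewrite -E addrK.
Qed.

Lemma finite_truncated_roots :
  exists l : seq (rgrp R n), forall e s, truncated_roots e s -> e \in l.
Proof.
apply: (@finite_of_finite_roots n C _ [seq q.2 | q <- reachable (\sum_j m j).+1] m).
  move=> e s h i; split; first by case: h.
  move=> b bs; have hb := truncated_roots_reachable h bs.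
  by apply/mapP; exists (i, b).
by move=> e e' s; exact: truncated_roots_inj.
Qed.

Hypothesis d_gt0 : forall i, (0 < d i)%N.
Hypothesis Htrunc : forall j, rgrp_coweight r j - mu j = \sum_(i < n) (m i)%:Z * c i j.

Lemma factors_truncated_roots e : (forall i, rgrp_coweight e i = mu i) ->
  factors_through_truncation c d mu r m e -> exists s, truncated_roots e s.
Proof.
move=> e_mu [A [V [x [xi [v [rels [v0 [xv [xiv [_ tr]]]]]]]]]].
have [N [NC CN]] := cartan_inverse R posdef.
pose chi i : nat -> C^o := (rgrp_ser C^o e i).2.
pose a := gklo_sol (T := C^o) c d mu r m N chi.
pose Aser i : ser C^o := ((m i)%:Z, a i).
have a_tr i k : (m i < k)%N -> a i k = 0.
  exact: (eigen_trunc c_diag c_off Htrunc e_mu NC rels v0 xiv tr).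
(* Orders beyond [m i] are the negative powers of [u], so truncation makes the eigenvalue of
   [A_i(u)] a monic polynomial. *)
have H i : exists si, Aser i = root_ser si.
  apply: root_ser_exists => [|p p0]; first exact: gklo_sol0.
  by rewrite /scoef /= a_tr ?if_same //; lia.
have [s hs] : exists s, forall i, Aser i = root_ser (s i).
  by exists (fun i => projT1 (boolp.cid (H i))) => i; case: (boolp.cid (H i)).
have eqn i := gklo_defect_eq c_diag c_off Htrunc (eigen_defect d mu r m e c_diag c_off NC i).
exists s; split.
- by move=> j; have := congr1 fst (hs j); rewrite root_ser_deg => -[].
- move=> i; have := eqn i; rewrite /gklo_lhs /gklo_rhs -(rgrp_serE e_mu) -/(Aser i) hs => ->.
  by congr (_ ** ser_prod _); apply: eq_map => p; rewrite -hs.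
- move=> i; apply: root_ser_exists => [|p p0].
    by rewrite ser_mul_lead ?rgrp_ser_lead ?root_ser_lead.
  rewrite -hs.
  exact: (trunc_polynomial c_diag c_off c_sym d_gt0 Htrunc e_mu NC CN rels v0 xv xiv tr).
Qed.

End Finiteness.

Theorem theorem9p2 (R : realType) (n : nat) (c : 'I_n -> 'I_n -> int)
    (d : 'I_n -> nat) (Hg : simple_cartan_data c d)
    (mu : 'I_n -> int) (r : rgrp R n) (m : 'I_n -> nat)
    (Htrunc : forall j, rgrp_coweight r j - mu j = \sum_(i < n) (m i)%:Z * c i j) :
  exists s : seq (rgrp R n), forall e : rgrp R n,
    (forall i, rgrp_coweight e i = mu i) ->
    factors_through_truncation c d mu r m e ->
    e \in s.
Proof.
have [_ [c_diag [c_off [c_sym [_ [posdef _]]]]]] := Hg.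
have [l hl] := finite_truncated_roots r m c_diag (fun i j => (c_sym i j).2) posdef.
exists l => e e_mu he.
have [s hs] := factors_truncated_roots c_diag c_off (fun i j => (c_sym i j).2)
  posdef (fun i => (c_sym i i).1) Htrunc e_mu he.
exact: hl hs.
Qed.
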